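(* Assume that $\mathrm S$ and $\mathbb U$ are compact. For each $r\in\mathbb N$ let $\mathbb P_r\in\mathcal P(\mathcal P(\mathbb X)\times\mathcal P(\mathbb X))$ be the empirical distribution associated with a data set $\mathcal D_r$, and assume that $\mathbb P_r\to\mathbb P$ weakly in $\mathcal P(\mathcal P(\mathbb X)\times\mathcal P(\mathbb X))$. If $\underline U_r^*\in\operatorname{argmin}_{\underline U\in\mathbb U^T}V(\mathbb P_r,\underline U)$ for all $r\in\mathbb N$, then the sequence $(\underline U_r^* )_{r\in\mathbb N}$ has a limit point (limit of a subsequence) $\underline U^*\in\mathbb U^T$ such that $\underline U^*\in\operatorname{argmin}_{\underline U\in\mathbb U^T}V(\mathbb P,\underline U)$.
   Context: Fix integers $N,d,d_1,d_2,T\ge1$, $\beta>0$, $\lambda>0$. Let $\emptyset\ne\mathrm S\subset\mathbb R^d$, $p_i:=i/N$, $\mathrm{PE}_N:=\{p_1,\dots,p_N\}$, $\mathbb X:=\mathrm{PE}_N\times\mathrm S$. Let $\sigma:\mathbb R^{d_1}\to\mathbb R^{d_1}$ be $1$-Lipschitz. The action space $\mathbb U$ is a nonempty subset of $\mathbb R^{d\times d_1}\times\mathbb R^{d_1\times d}\times\mathbb R^{d_1}\times\mathbb R^{d_2\times d}\times\mathbb R^{d_2\times d}\times\mathbb R^{d\times d}$ with the Euclidean (product Frobenius) norm; its elements are written $U=(\mathsf W,\mathsf A,\mathsf b,\mathsf Q,\mathsf K,\mathsf V)$. $\mathcal P(\Omega)$ denotes the Borel probability measures on $\Omega$, with the topology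 of weak convergence (convergence against bounded continuous functions); $\mathcal P(\mathbb X)\times\mathcal P(\mathbb X)$ carries the product topology. For $\mu\in\mathcal P(\mathbb X)$, $\mu_{\mathrm S}$ is its marginal on $\mathrm S$. Define $f:\mathbb X\times\mathbb U\times\mathcal P(\mathbb X)\to\mathbb X$ by $$f((p,x),U,\mu):=\Big(p,\ \mathsf W\sigma(\mathsf Ax+\mathsf b)+\frac{\int_{\mathrm S}e^{\beta\langle\mathsf Qx,\mathsf Kz\rangle}\mathsf Vz\,\mu_{\mathrm S}(dz)}{\int_{\mathrm S}e^{\beta\langle\mathsf Qx,\mathsf Kz\rangle}\mu_{\mathrm S}(dz)}\Big);$$ it is a standing convention that $f$ is $\mathbb X$-valued. Let $\Phi(\mu,U):=\mu\circ f(\cdot,U,\mu)^{-1}$ (push-forward). For $\underline U=(U_0,\dots,U_{T-1})\in\mathbb U^T$ let $\Phi_T(\mu,\underline U)$ be the terminal measure $\mu_T$ of the recursion $\mu_0=\mu$, $\mu_{t+1}=\Phi(\mu_t,U_t)$, $t=0,\dots,T-1$. $W_{2,\lambda}(P,Q):=\big(\inf_\pi\int(\|x-y\|_2^2+\lambda|p-q|^2)\,\pi(d(p,x),d(q,y))\big)^{1/2}$ over couplings $\pi$ of $P,Q\in\mathcal P(\mathbb X)$. For $P\in\mathcal P(\mathcal P(\mathbb X)\times\mathcal P(\mathbb X))$ and $\underline U\in\mathbb U^T$, $$V(P,\underline U):=\int_{\mathcal P(\mathbb X)\times\mathcal P(\mathbb X)}W_{2,\lambda}(\Phi_T(\mu,\underline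 U),\nu)^2\,P(d\mu,d\nu).$$ A data set is $\mathcal D_r=\{(\mathbf x^{k,r},\mathbf y^{k,r}):k=1,\dots,K_r\}\subset\mathrm S^N\times\mathrm S^N$, and its empirical distribution is $\mathbb P_r:=\frac1{K_r}\sum_{k=1}^{K_r}\delta_{(\mu_0^{k,r},\nu^{k,r})}$ with $\mu_0^{k,r}:=\frac1N\sum_{i=1}^N\delta_{(p_i,x^{i,k,r})}$, $\nu^{k,r}:=\frac1N\sum_{i=1}^N\delta_{(p_i,y^{i,k,r})}$. *)

(* Defs.v *)
From HB Require Import structures.
From mathcomp Require Import all_boot all_order all_algebra.
From mathcomp Require Import all_classical all_reals all_analysis.
Import numFieldNormedType.Exports.

Set Implicit Arguments.
Unset Strict Implicit.
Unset Printing Implicit Defensive.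

Import Order.TTheory GRing.Theory Num.Theory.
Local Open Scope classical_set_scope.
Local Open Scope ring_scope.

(* The subspace [set_type A], pointed by means of the proof [A0] because
   [measurableType] requires pointed carriers. *)
Definition subT (T : topologicalType) (A : set T) (A0 : A !=set0) : Type :=
  set_type A.

Section subT_instances.
Variables (T : topologicalType) (A : set T) (A0 : A !=set0).

HB.instance Definition _ := Topological.copy (subT A0) (set_type A).
HB.instance Definition _ := isPointed.Build (subT A0)
  (SigSub (mem_set (projT2 (cid A0)))).

End subT_instances.

HB.instance Definition _ (T T' : ptopologicalType) := Pointed.on (T * T')%type.

Notation borel T := (g_sigma_algebraType (@open T)).

Section Prob.
Variables (R : realType) (T : ptopologicalType).

Definition Prob : Type := probability (borel T) R.

HB.instance Definition _ := Choice.copy Prob (probability (borel T) R).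
HB.instance Definition _ := isPointed.Build Prob (dirac (point : borel T)).

Definition BC : Type :=
  {h : T -> R | continuous h /\ exists M : R, forall x, `|h x| <= M}.

Definition BC_integrals (mu : Prob) : {ptws BC -> R} :=
  fun h => \int[mu]_(x in [set: borel T]) projT1 h x.

(* Topology of weak convergence: the coarsest one for which all the maps
   mu |-> \int h dmu, with h bounded and continuous, are continuous. *)
HB.instance Definition _ :=
  Topological.copy Prob (initial_topology BC_integrals).

End Prob.

Section push.
Variables (R : realType) (T T' : ptopologicalType).

Section push_measurable.
Variables (f : borel T -> borel T') (mf : measurable_fun [set: borel T] f).
Variable mu : Prob R T.

Let m := pushforward (mu : probability (borel T) R) f.
Let m0 : m set0 = 0%E. Proof. exact: measure0. Qed.
Let m_ge0 A : (0 <= m A)%E. Proof. exact: measure_ge0. Qed.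
Let m_sigma_additive : semi_sigma_additive m.
Proof. exact: measure_semi_sigma_additive. Qed.
HB.instance Definition _ := isMeasure.Build _ _ _ m m0 m_ge0 m_sigma_additive.
Let m_setT : m setT = 1%E.
Proof. by rewrite /m /pushforward preimage_setT probability_setT. Qed.
HB.instance Definition _ := Measure_isProbability.Build _ _ _ m m_setT.

Definition push_measurable : Prob R T' := m.

End push_measurable.

(* [push f mu] is mu \o f^-1 when f is Borel (see [pushE]); otherwise it is an
   arbitrary value. It is only used below for maps that are Borel: see
   [continuous_borel] for the projections and [f_borel] for the layer map. *)
Definition push (f : T -> T') (mu : Prob R T) : Prob R T' :=
  if pselect (measurable_fun [set: borel T] (f : borel T -> borel T'))
    is left mf then push_measurable mf mu else point.

Lemma pushE f mu (A : set (borel T')) :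
    measurable_fun [set: borel T] (f : borel T -> borel T') ->
  (push f mu : probability _ _) A = (mu : probability _ _) (f @^-1` A).
Proof. by rewrite /push; case: pselect. Qed.

Lemma continuous_borel (f : T -> T') : continuous f ->
  measurable_fun [set: borel T] (f : borel T -> borel T').
Proof.
move=> cf; apply: (measurability (@open T' : set (set (borel T')))) => //.
move=> _ [B oB <-]; rewrite setTI; apply: sub_sigma_algebra.
by apply: open_comp oB => x _; exact: cf.
Qed.

End push.

Section uniform_measure.
Variables (R : realType) (T : ptopologicalType).
Variables (n : nat) (n0 : (0 < n)%N) (a : 'I_n -> T).

Let m (n0 : (0 < n)%N) (A : set (borel T)) : \bar R :=
  ((n%:R^-1)%:E * \sum_(i < n) \d_(a i : borel T) A)%E.
Local Notation m' := (m n0).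

Let m_0 : m' set0 = 0%E.
Proof. by rewrite /m big1 ?mule0// => i _; rewrite measure0. Qed.

Let m_ge0 A : (0 <= m' A)%E.
Proof.
by rewrite /m mule_ge0 ?lee_fin ?invr_ge0//; apply: sume_ge0 => i _.
Qed.

Let m_sigma_additive : semi_sigma_additive m'.
Proof.
move=> F mF tF mUF; rewrite /m.
rewrite (_ : (fun k => _) = fun k => ((n%:R^-1)%:E *
    \sum_(i < n) \sum_(0 <= j < k) \d_(a i : borel T) (F j))%E).
  apply: cvgeZl => //; apply: cvg_nnesum => i _.
    by apply: nearW => k; apply: sume_ge0 => j _.
  exact: measure_semi_sigma_additive.
apply/funext => k; rewrite exchange_big/= ge0_sume_distrr// => j _.
exact: sume_ge0.
Qed.

HB.instance Definition _ :=
  isMeasure.Build _ _ _ m' m_0 m_ge0 m_sigma_additive.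

Let m_setT : m' setT = 1%E.
Proof.
rewrite /m (eq_bigr (fun=> 1%E)) => [|i _]; last by rewrite diracT.
rewrite sumEFin sumr_const card_ord -EFinM mulVf// pnatr_eq0.
by rewrite -lt0n.
Qed.

HB.instance Definition _ := Measure_isProbability.Build _ _ _ m' m_setT.

(* (1/n) \sum_(i < n) \delta_(a i) *)
Definition uniform_measure : Prob R T := m'.

End uniform_measure.

Definition enorm (R : realType) (n : nat) (x : 'cV[R]_n) : R :=
  Num.sqrt (\sum_i x i 0 ^+ 2).

Definition dotp (R : realType) (n : nat) (x y : 'cV[R]_n) : R :=
  \sum_i x i 0 * y i 0.

(* Parameters (W, A, b, Q, K, V). *)
Definition param (R : realType) (d d1 d2 : nat) : Type :=
  ('M[R]_(d, d1) * 'M[R]_(d1, d) * 'cV[R]_d1 *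
   'M[R]_(d2, d) * 'M[R]_(d2, d) * 'M[R]_(d, d))%type.

Definition PE (R : realType) (N : nat) : set R :=
  [set p | exists i : 'I_N, p = i.+1%:R / N%:R].
Arguments PE : clear implicits.

Lemma PE_ord (R : realType) (N : nat) (i : 'I_N) : PE R N (i.+1%:R / N%:R).
Proof. by exists i. Qed.

Lemma PE_neq0 (R : realType) (N : nat) : (0 < N)%N -> PE R N !=set0.
Proof. by move=> N0; exists (1%:R / N%:R); exists (Ordinal N0). Qed.

Definition state (R : realType) (N d : nat) (N0 : (0 < N)%N)
    (S : set 'cV[R]_d) (S0 : S !=set0) : ptopologicalType :=
  (subT (PE_neq0 R N0) * subT S0)%type.

Section continuity.
Variable R : realType.

Lemma continuous_sum (T : topologicalType) (I : Type) (s : seq I)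
  (g : I -> T -> R) : (forall i, continuous (g i)) ->
  continuous (fun t => \sum_(i <- s) g i t).
Proof.
move=> cg x; elim: s => [|i s IH].
  by under eq_fun do rewrite big_nil; exact: cst_continuous.
under eq_fun do rewrite big_cons.
by apply: continuousD => //; exact: cg.
Qed.

Lemma continuous_mx (T : topologicalType) m n (g : T -> 'M[R]_(m, n)) :
  (forall i j, continuous (fun t => g t i j)) -> continuous g.
Proof.
move=> cg x; apply/cvg_ballP => e e0.
near=> y.
have h : forall ij : 'I_m * 'I_n, ball (g x ij.1 ij.2) e (g y ij.1 ij.2).
  near: y; apply: filter_forall => -[i j] /=.
  exact: (cvg_ball (cg i j x)).
by split => // i j; exact: (h (i, j)).
Unshelve. all: by end_near. Qed.

Lemma continuous_mulmx (T : topologicalType) m n (M : 'M[R]_(m, n))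
   (g : T -> 'cV[R]_n) : continuous g -> continuous (fun t => M *m g t).
Proof.
move=> cg; apply: continuous_mx => i j.
under eq_fun do rewrite mxE.
apply: continuous_sum => k x; apply: continuousM; first exact: cst_continuous.
apply: (@continuous_comp _ _ _ g (fun M : 'cV[R]_n => M k j)); first exact: cg.
exact: coord_continuous.
Qed.

Lemma coordC (T : topologicalType) n (g : T -> 'cV[R]_n) i :
  continuous g -> continuous (fun t => g t i 0).
Proof.
move=> cg x.
apply: (@continuous_comp _ _ _ g (fun M : 'cV[R]_n => M i 0)); first exact: cg.
exact: coord_continuous.
Qed.

Lemma enorm_coord n (x : 'cV[R]_n) i : `|x i 0| <= enorm x.
Proof.
rewrite -sqrtr_sqr ler_wsqrtr// (bigD1 i)//= lerDl.
by apply: sumr_ge0 => j _; exact: sqr_ge0.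
Qed.

Lemma enorm_continuous (T : topologicalType) n (g : T -> 'cV[R]_n) :
  continuous g -> continuous (fun t => enorm (g t)).
Proof.
move=> cg x; apply: (@continuous_comp _ _ _ (fun t => \sum_i g t i 0 ^+ 2)).
  apply: continuous_sum => i {}x; rewrite /= .
  by apply: continuousM; exact: coordC.
exact: sqrt_continuous.
Qed.

Lemma lip_continuous m n (s : 'cV[R]_m -> 'cV[R]_n) :
  (forall u v, enorm (s u - s v) <= enorm (u - v)) -> continuous s.
Proof.
move=> hs; apply: continuous_mx => i j x; rewrite (ord1 j).
apply/(@cvgrPdist_lt _ _ _ (nbhs x)) => e e0.
have h : continuous (fun t : 'cV[R]_m => enorm (x - t)).
  apply: enorm_continuous => y; apply: continuous_mx => {}i {}j z.
  under eq_fun do rewrite !mxE.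
  apply: continuousB; [exact: cst_continuous | exact: coord_continuous].
have := h x; rewrite /continuous_at.
have -> : enorm (x - x) = 0.
  by rewrite subrr /enorm big1 ?sqrtr0// => k _; rewrite mxE expr0n.
move=> /(@cvgr0_norm_lt _ _ _ (nbhs x)) /(_ e e0); apply: filterS => t /=.
rewrite ger0_norm ?sqrtr_ge0// => ht.
apply: le_lt_trans ht; apply: le_trans (hs x t).
by have := enorm_coord (s x - s t) i; rewrite !mxE.
Qed.

Lemma continuous_into_sub (T T' : topologicalType) (A : set T) (A0 : A !=set0)
  (g : T' -> subT A0) : continuous (fun t => val (g t)) -> continuous g.
Proof.
move=> cg; apply/continuousP => _ [B oB <-].
by move/continuousP : cg; apply.
Qed.

Lemma continuous_val (T : topologicalType) (A : set T) (A0 : A !=set0) :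
  continuous (val : subT A0 -> T).
Proof. exact: (@initial_continuous _ _ (set_val : set_type A -> T)). Qed.

Lemma compact_sub (T : topologicalType) (A : set T) (A0 : A !=set0) :
  compact A -> compact [set: subT A0].
Proof.
move=> cA F FF _.
have FF' : ProperFilter ((val : subT A0 -> T) @ F) by exact: fmap_proper_filter.
have [|x [Ax cx]] := cA _ FF'.
  by apply: (@filterE _ F) => -[x xA] /=; exact: set_mem xA.
exists (SigSub (mem_set Ax)); split => // B C FB [_ [ [W oW <-] Wx WC] ].
have Wn : nbhs x W by exact: open_nbhs_nbhs.
have FB' : ((val : subT A0 -> T) @ F) (val @` B).
  by apply: (@filterS _ F _ B) => // z Bz; exists z.
have [y []] := cx _ _ FB' Wn.
by move=> [z Bz <-] Wz; exists z; split => //; exact: WC.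
Qed.

Lemma prob_integrable (T : ptopologicalType) (mu : probability (borel T) R)
    (h : T -> R) :
  compact [set: T] -> continuous h ->
  mu.-integrable [set: borel T] (EFin \o h).
Proof.
move=> cT ch; apply: measurable_bounded_integrable => //.
- by apply: (le_lt_trans (probability_le1 mu measurableT)); rewrite ltry.
- apply: (measurability _ (measurable_realfun.RGenOpens.measurableE R)).
  move=> _ [B [x [y ->] ] <-]; rewrite setTI; apply: sub_sigma_algebra.
  have oB : open `]x, y[%classic by exact: interval_open.
  by apply: open_comp oB => z _; exact: ch.
- have [M [Mr Mh]] :=
    compact_bounded (continuous_compact (continuous_subspaceT ch) cT).
  exists M; split=> // r /Mh hr x _; apply: hr; by exists x.
Qed.

Lemma continuous_slice (Y T : topologicalType) (F : Y -> T -> R) :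
  continuous (fun yt : Y * T => F yt.1 yt.2) -> forall y, continuous (F y).
Proof.
move=> cF y t; apply: (@continuous_comp _ _ _ (fun t => (y, t))
  (fun yt => F yt.1 yt.2)); last exact: cF.
by apply: cvg_pair; [exact: cvg_cst|exact: cvg_id].
Qed.

Lemma continuous_integral (Y : topologicalType) (T : ptopologicalType)
  (mu : probability (borel T) R)
  (F : Y -> T -> R) : compact [set: T] ->
  continuous (fun yt : Y * T => F yt.1 yt.2) ->
  continuous (fun y => \int[mu]_(t in [set: borel T]) F y t).
Proof.
move=> cT cF y; apply/(@cvgrPdist_le _ _ _ (nbhs y)) => e e0.
have ch := continuous_slice cF.
have : \forall z \near nbhs y, [set: T] `<=` [set t | `|F y t - F z t| <= e].
  move/compact_near_coveringP : cT; apply => t _.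
  have ct : F y tz.1 - F tz.2 tz.1 @[tz --> (t, y)] --> (0 : R).
    rewrite -(subrr (F y t)); apply: cvgB.
      apply: (@cvg_comp _ _ _ fst (F y) _ (nbhs t)); last exact: ch.
      exact: cvg_fst.
    apply: (@cvg_comp _ _ _ (fun tz : T * Y => (tz.2, tz.1))
      (fun yt => F yt.1 yt.2) _ (nbhs (y, t))); last exact: (cF (y, t)).
    by apply: cvg_pair; [exact: cvg_snd|exact: cvg_fst].
  by move/(@cvgr0_norm_le _ _ _ (nbhs (t, y))) : ct => /(_ e e0).
apply: filterS => z hz.
rewrite -RintegralB//; [|exact: prob_integrable..].
have iB : mu.-integrable [set: borel T]
    (EFin \o (fun t => F y t - F z t)).
  by apply: prob_integrable => // t; apply: continuousB; exact: ch.
apply: le_trans (le_normr_Rintegral _ iB) _ => //.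
have -> : e = \int[mu]_(t in [set: borel T]) e.
  rewrite Rintegral_cst// [X in fine X](_ : _ = 1%E) ?mulr1//.
  exact: (probability_setT (mu : probability (borel T) R)).
apply: le_Rintegral => //.
- apply: (prob_integrable mu (h := fun t => `|F y t - F z t|)) => // t.
  apply: (@continuous_comp _ _ _ (fun t => F y t - F z t) Num.norm).
    by apply: continuousB; exact: ch.
  exact: norm_continuous.
- by apply: prob_integrable => //; exact: cst_continuous.
Qed.

End continuity.

Section model.
Variables (R : realType) (N d d1 d2 T : nat) (N0 : (0 < N)%N).
Variables (beta lambda : R) (S : set 'cV[R]_d) (S0 : S !=set0).
Variables (sigma : 'cV[R]_d1 -> 'cV[R]_d1) (UU : set (param R d d1 d2)).

Local Notation X := (state N0 S0).

Definition attention (Q K : 'M[R]_(d2, d)) (V : 'M[R]_(d, d))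
    (nu : Prob R (subT S0)) (x : 'cV[R]_d) : 'cV[R]_d :=
  let w z := expR (beta * dotp (Q *m x) (K *m z)) in
  \col_i ((\int[nu]_(z in [set: borel (subT S0)])
             (w (val z) * (V *m val z) i 0))
          / \int[nu]_(z in [set: borel (subT S0)]) w (val z)).

Definition layer (x : 'cV[R]_d) (U : param R d d1 d2) (mu : Prob R X) :
    'cV[R]_d :=
  let: (W, A, b, Q, K, V) := U in
  W *m sigma (A *m x + b) + attention Q K V (push snd mu) x.

(* The standing convention that f takes its values in X. *)
Definition layer_valued : Prop :=
  forall (x : 'cV[R]_d) (U : param R d d1 d2) (mu : Prob R X),
    S x -> UU U -> S (layer x U mu).

Hypothesis HS : layer_valued.

Definition f (px : X) (U : set_type UU) (mu : Prob R X) : X :=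
  (px.1, SigSub (mem_set
    (HS mu (set_mem (valP px.2)) (set_mem (valP U))))).

Definition Phi (mu : Prob R X) (U : set_type UU) : Prob R X :=
  push (fun px => f px U mu) mu.

Definition controls : topologicalType :=
  {ptws 'I_T -> set_type UU}.

Definition PhiT (mu : Prob R X) (U : controls) : Prob R X :=
  foldl (fun m t => Phi m (U t)) mu (enum 'I_T).

Definition couplings (P Q : Prob R X) : set (Prob R (X * X)%type) :=
  [set pi | push fst pi = P /\ push snd pi = Q].

Definition cost (z w : X) : R :=
  enorm (val z.2 - val w.2) ^+ 2 + lambda * `|val z.1 - val w.1| ^+ 2.

Definition W2 (P Q : Prob R X) : \bar R :=
  sqrte (ereal_inf
    [set (\int[pi]_(zw in [set: borel (X * X)%type]) (cost zw.1 zw.2)%:E)%E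
       | pi in couplings P Q]).

Definition V (P : Prob R (Prob R X * Prob R X)%type) (U : controls) : \bar R :=
  (\int[P]_(mn in [set: borel (Prob R X * Prob R X)%type])
    (W2 (PhiT mn.1 U) mn.2 ^+ 2))%E.

Definition argminV (P : Prob R (Prob R X * Prob R X)%type) : set controls :=
  [set U | forall U' : controls, (V P U <= V P U')%E].

Record dataset := Dataset {
  dsize : nat;
  dsize_gt0 : (0 < dsize)%N;
  input : 'I_dsize -> 'I_N -> subT S0;
  output : 'I_dsize -> 'I_N -> subT S0 }.

Definition tokens (x : 'I_N -> subT S0) : Prob R X :=
  uniform_measure R N0
    (fun i => (SigSub (mem_set (PE_ord R i)) : subT (PE_neq0 R N0), x i) : X).

Definition empirical (D : dataset) : Prob R (Prob R X * Prob R X)%type :=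
  uniform_measure R (dsize_gt0 D)
    (fun k => (tokens (input k), tokens (output k))).

End model.
Arguments empirical {R N d} N0 {S S0} D.

(* When S is compact and sigma is 1-Lipschitz, f(., U, mu) is continuous, so
   that [Phi] is a genuine push-forward. *)
Lemma f_borel (R : realType) (N d d1 d2 : nat) (N0 : (0 < N)%N) (beta : R)
    (S : set 'cV[R]_d) (S0 : S !=set0) (sigma : 'cV[R]_d1 -> 'cV[R]_d1)
    (UU : set (param R d d1 d2)) (HS : layer_valued N0 beta S0 sigma UU)
    (U : set_type UU) (mu : Prob R (state N0 S0)) :
  compact S -> (forall u v, enorm (sigma u - sigma v) <= enorm (u - v)) ->
  measurable_fun [set: borel (state N0 S0)]
    ((fun px => f HS px U mu) : borel (state N0 S0) -> borel (state N0 S0)).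
Proof.
move=> cS lip; apply: continuous_borel.
suff c2 : continuous (fun px => (f HS px U mu).2).
  move=> px; apply: (@cvg_pair _ _ _ (nbhs px) (nbhs px.1)
    (nbhs (f HS px U mu).2) _ _ _ fst (fun px => (f HS px U mu).2)).
    exact: cvg_fst.
  exact: c2.
have cval : continuous (fun px : state N0 S0 => val px.2).
  move=> px; apply: (@cvg_comp _ _ _ snd (val : subT S0 -> _) _ (nbhs px.2)).
    exact: cvg_snd.
  exact: continuous_val.
apply: continuous_into_sub => /=.
move: (HS) (U) => HU [[[[[[W A] b] Q] K] V] /= xU]; rewrite /layer.
move: (push snd mu) => nu.
set T := subT S0.
have cT : compact [set: T] by exact: compact_sub.
have cw : continuous (fun xz : state N0 S0 * T =>
    expR (beta * dotp (Q *m val xz.1.2) (K *m val xz.2))).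
  move=> xz; apply: continuous_comp; last exact: continuous_expR.
  apply: continuousM; first exact: cst_continuous.
  move: xz; apply: continuous_sum => i xz; apply: continuousM; move: xz.
    apply: coordC; apply: continuous_mulmx => xz.
    apply: (@cvg_comp _ _ _ fst (fun px : state N0 S0 => val px.2) _
      (nbhs xz.1)).
      exact: cvg_fst.
    exact: cval.
  apply: coordC; apply: continuous_mulmx => xz.
  apply: (@cvg_comp _ _ _ snd (val : T -> _) _ (nbhs xz.2)).
    exact: cvg_snd.
  exact: continuous_val.
have cV : forall i,
    continuous (fun xz : state N0 S0 * T => (V *m val xz.2) i 0).
  move=> i; apply: coordC; apply: continuous_mulmx => xz.
  apply: (@cvg_comp _ _ _ snd (val : T -> _) _ (nbhs xz.2)).
    exact: cvg_snd.
  exact: continuous_val.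
apply: continuous_mx => i j; rewrite (ord1 j).
under eq_fun do rewrite mxE [X in _ + X]mxE.
have h1 : continuous (fun px : state N0 S0 =>
    (W *m sigma (A *m val px.2 + b)) i 0).
  apply: coordC; apply: continuous_mulmx => px.
  apply: (@continuous_comp _ _ _ (fun px : state N0 S0 => A *m val px.2 + b)
    sigma); last exact: lip_continuous.
  move: px; apply: continuous_mx => {}i {}j.
  under eq_fun do rewrite mxE.
  move=> px; apply: continuousD; last exact: cst_continuous.
  by rewrite (ord1 j); move: px; apply: coordC; apply: continuous_mulmx.
have h2 : continuous (fun px : state N0 S0 =>
    \int[nu]_(z in [set: borel (subT S0)])
    (expR (beta * dotp (Q *m val px.2) (K *m val z)) * (V *m val z) i 0)).
  have cF : continuous (fun xz : state N0 S0 * T =>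
    expR (beta * dotp (Q *m val xz.1.2) (K *m val xz.2)) * (V *m val xz.2) i 0).
    by move=> xz; exact: (cvgM (cw xz) (cV i xz)).
  exact: (@continuous_integral R (state N0 S0) (subT S0) nu (fun px z =>
    expR (beta * dotp (Q *m val px.2) (K *m val z)) * (V *m val z) i 0) cT cF).
have h3 : continuous (fun px : state N0 S0 =>
    \int[nu]_(z in [set: borel (subT S0)])
    expR (beta * dotp (Q *m val px.2) (K *m val z))).
  exact: (@continuous_integral R (state N0 S0) (subT S0) nu (fun px z =>
    expR (beta * dotp (Q *m val px.2) (K *m val z))) cT cw).
move=> px.
have h4 : \int[nu]_(z in [set: borel (subT S0)])
    expR (beta * dotp (Q *m val px.2) (K *m val z)) != 0.
  have cwx : continuous (fun z : T =>
      expR (beta * dotp (Q *m val px.2) (K *m val z))).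
    exact: (@continuous_slice R (state N0 S0) T (fun px z =>
      expR (beta * dotp (Q *m val px.2) (K *m val z))) cw px).
  have cwi : continuous (fun z : T =>
      (expR (beta * dotp (Q *m val px.2) (K *m val z)))^-1).
    by move=> z; exact: (cvgV (lt0r_neq0 (expR_gt0 _)) (cwx z)).
  have [M [Mr /(_ (`|M| + 1))]] :=
    compact_bounded (continuous_compact (continuous_subspaceT cwi) cT).
  rewrite ltr_pwDr ?ler_norm// => /(_ isT) hM.
  have M0 : 0 < `|M| + 1 by rewrite ltr_wpDl.
  have lb z : (`|M| + 1)^-1 <=
      expR (beta * dotp (Q *m val px.2) (K *m val (z : T))).
    have /hM : range (fun z : T =>
      (expR (beta * dotp (Q *m val px.2) (K *m val z)))^-1)
      (expR (beta * dotp (Q *m val px.2) (K *m val z)))^-1 by exists z.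
    rewrite /= gtr0_norm ?invr_gt0 ?expR_gt0// => h.
    by rewrite -[leRHS]invrK lef_pV2// posrE invr_gt0 expR_gt0.
  rewrite gt_eqF//; apply: (@lt_le_trans _ _ (`|M| + 1)^-1).
    by rewrite invr_gt0.
  have -> : (`|M| + 1)^-1 =
      \int[nu]_(z in [set: borel (subT S0)]) (`|M| + 1)^-1.
    rewrite Rintegral_cst// [X in fine X](_ : _ = 1%E) ?mulr1//.
    exact: (probability_setT (nu : probability (borel (subT S0)) R)).
  apply: le_Rintegral => //.
  - apply: (@prob_integrable R (subT S0) nu (fun=> (`|M| + 1)^-1)) => //.
    exact: cst_continuous.
  - exact: (@prob_integrable R (subT S0) nu _ cT cwx).
exact: (cvgD (h1 px) (cvgM (h2 px) (cvgV h4 (h3 px)))).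
Qed.

(* Main.v *)
Require Import Defs.
From HB Require Import structures.
From mathcomp Require Import all_boot all_order all_algebra.
From mathcomp Require Import all_classical all_reals all_analysis.
From mathcomp Require Import measurable_realfun ring.
Import numFieldNormedType.Exports.
Import Order.TTheory GRing.Theory Num.Theory.
Local Open Scope classical_set_scope.
Local Open Scope ring_scope.

Set Implicit Arguments.
Unset Strict Implicit.
Unset Printing Implicit Defensive.

(* The empirical measures charge only pairs of token measures
   (1/N) \sum_i \delta_(p_i, x_i). These are the zeros of a weakly continuous
   function, the [defect], built from the masses and the variances of mu on the
   slices {p_i} * S; hence the limit P charges only such pairs as well. On them,
   Phi_T is an explicit finite-dimensional map of (x_1, .., x_N), the barycenters
   of the slices, and W_2^2 is the value of a finite transport problem whose cost
   matrix is continuous in the tokens. So V is the integral of a bounded weakly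
   continuous function, and compactness of (S^N)^2 makes this function depend
   uniformly on U. Passing to the limit in V(P_r, U_r) <= V(P_r, U') along a
   convergent subsequence gives the claim. *)

(** * Borel probability measures and atomic measures *)

(** Weak convergence handles one fixed bounded continuous integrand, whereas the integrand of [V]
    moves with the control and, away from token measures, is known neither to be continuous nor to
    be measurable. It is therefore exchanged, off a null set of the measure at hand, for a genuine
    test function. The integral of a nonnegative function is a supremum over simple functions below
    it, so the exchange only requires agreement on the zeros of some measurable nonnegative function
    of integral zero. [S] is not assumed convex, so a barycenter may leave [S]; it is the mass 1/N
    of every slice, also recorded in [defect], that forces the barycenters into [S] when the defect
    vanishes. A second obstacle is formal: elements of [Prob] also have values on non-Borel sets, so
    equality in [Prob], which [couplings] demands, is stronger than agreement on Borel sets.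
    Couplings built by hand must be corrected on non-Borel sets. *)

Lemma eq_Prob (R : realType) (T : ptopologicalType) (m1 m2 : Prob R T) :
  (forall A, (m1 : probability (borel T) R) A = (m2 : probability (borel T) R) A)
  -> m1 = m2.
Proof.
move=> /funext.
case: m1 => m1 [[a1 a2] [a3] [a4] [a5] [a6] [a7] [a8]].
case: m2 => m2 [[b1 b2] [b3] [b4] [b5] [b6] [b7] [b8]] /= E; subst m2.
by rewrite (Prop_irrelevance b1 a1) (Prop_irrelevance b2 a2)
  (Prop_irrelevance b3 a3) (Prop_irrelevance b4 a4) (Prop_irrelevance b5 a5)
  (Prop_irrelevance b6 a6) (Prop_irrelevance b7 a7) (Prop_irrelevance b8 a8).
Qed.

Import HBNNSimple.

(* Neither [f] nor [g] is assumed to be measurable: the integrand of [V] is not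
   known to be. *)
Lemma eq_integral_off_null d (T : measurableType d) (R : realType)
    (mu : {measure set T -> \bar R}) (L f g : T -> \bar R) :
  measurable_fun [set: T] L -> (forall x, 0 <= L x)%E ->
  (\int[mu]_x L x = 0)%E ->
  (forall x, 0 <= f x)%E -> (forall x, 0 <= g x)%E ->
  (forall x, L x = 0%E -> f x = g x) ->
  (\int[mu]_x f x = \int[mu]_x g x)%E.
Proof.
move=> mL L0 iL.
suff le f' g' : (forall x, 0 <= f' x)%E -> (forall x, 0 <= g' x)%E ->
    (forall x, L x = 0%E -> f' x = g' x) ->
    (\int[mu]_x f' x <= \int[mu]_x g' x)%E.
  move=> f0 g0 fg; apply/eqP; rewrite eq_le !le// => x /fg; exact: esym.
move=> f0 g0 fg.
have mA : measurable [set x | L x = 0%E].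
  have := mL measurableT [set 0%E] (emeasurable_set1 _).
  by rewrite setTI.
rewrite !ge0_integralTE//; apply/ge_ereal_sup => _ [h hf <-].
(* [h] is set to 0 outside the zeros of [L]: the result lies below [g], and its integral is still
   that of [h] because the complement of these zeros is null. *)
apply: ereal_sup_ubound; exists (proj_nnsfun h mA).
  move=> x /=; rewrite mindicE; case: (boolP (x \in _)) => [/set_mem/= xA|_].
    by rewrite mulr1 -fg.
  by rewrite mulr0.
have -> : sintegral mu (proj_nnsfun h mA) =
    (\int[mu]_x (proj_nnsfun h mA x)%:E)%E.
  by rewrite integral_nnsfun// patch_setT.
have -> : sintegral mu h = (\int[mu]_x (h x)%:E)%E.
  by rewrite integral_nnsfun// patch_setT.
apply: ge0_ae_eq_integral => //.
- by apply/measurable_EFinP; exact: measurable_funP.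
- by apply/measurable_EFinP; exact: measurable_funP.
- by move=> x _; rewrite lee_fin; exact: fun_ge0.
- by move=> x _; rewrite lee_fin; exact: fun_ge0.
have : ae_eq mu setT L (cst 0%E).
  apply/ae_eq_integral_abs => //.
  by under eq_integral do rewrite gee0_abs//.
apply: filterS => x /= /(_ Logic.I) Lx _.
by rewrite mindicE mem_set// mulr1.
Qed.

Lemma continuous_borel_real (R : realType) (T : ptopologicalType) (g : T -> R) :
  continuous g -> measurable_fun [set: borel T] g.
Proof.
move=> cg; apply: (measurability _ (RGenOpens.measurableE R)).
move=> _ [B [x [y ->] ] <-]; rewrite setTI; apply: sub_sigma_algebra.
have oB : open `]x, y[%classic by exact: interval_open.
by apply: open_comp oB => z _; exact: cg.
Qed.

Lemma ptws_eval_continuous (U : Type) (V : topologicalType) (u : U) :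
  continuous (fun f : {ptws U -> V} => f u).
Proof.
move=> f; have /cvg_sup/(_ u)/cvg_image : f --> f by exact: cvg_id.
move=> h; apply: cvg_trans (h _) => {h}.
  by move=> Q /= [W nW <-]; apply: filterS nW; exact: preimage_image.
by rewrite eqEsubset; split => y //; exists (fun=> y).
Qed.

Lemma ptws_cvg (U : Type) (V : topologicalType) (F : set_system {ptws U -> V})
    (f : {ptws U -> V}) : Filter F ->
  (forall u, (fun g : {ptws U -> V} => g u) @ F --> f u) -> F --> f.
Proof.
move=> FF Ff; apply/cvg_sup => u; apply/cvg_image.
  by rewrite eqEsubset; split => y //; exists (fun=> y).
move=> W /Ff FW; exists ((fun g : {ptws U -> V} => g u) @^-1` W) => //.
by rewrite eqEsubset; split => [y [g Wg <-]//|y Wy]; exists (fun=> y).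
Qed.

Lemma integral_Prob_continuous (R : realType) (T : ptopologicalType) (g : T -> R) :
  continuous g -> (exists M, forall x, `|g x| <= M) ->
  continuous (fun mu : Prob R T => \int[mu]_(x in [set: borel T]) g x).
Proof.
move=> cg bg mu.
pose h : BC R T := exist _ g (conj cg bg).
have := @initial_continuous (Prob R T) {ptws BC R T -> R} (@BC_integrals R T) mu.
move=> c1.
apply: (@continuous_comp _ _ _ (@BC_integrals R T)
  (fun F : {ptws BC R T -> R} => F h)); first exact: c1.
exact: ptws_eval_continuous.
Qed.

Section atomic.
Context (R : realType) (T : ptopologicalType) (I : finType).
Implicit Types (w : I -> R) (a : I -> T) (mu : Prob R T).

(* Measures agree only on Borel sets: a [Prob] also carries arbitrary values
   on the non-Borel sets. *)
Definition atomic mu w a := forall A : set (borel T), measurable A ->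
  (mu : probability (borel T) R) A = (\sum_i (w i)%:E * \d_(a i : borel T) A)%E.

Variables (w : I -> R) (w0 : forall i, 0 <= w i) (a : I -> T).

(** [msum] takes a sequence of measures indexed by [nat], so [I] is enumerated and the sequence is
    padded with the zero measure. *)
Let ms (k : nat) : {measure set (borel T) -> \bar R} :=
  if insub k is Some i then
    mscale (NngNum (w0 (enum_val (i : 'I_#|I|)))) (dirac (a (enum_val i) : borel T))
  else mzero.

Definition atomic_measure := msum ms #|I|.
HB.instance Definition _ := Measure.on atomic_measure.

Lemma atomic_measureE A :
  atomic_measure A = (\sum_i (w i)%:E * \d_(a i : borel T) A)%E.
Proof.
rewrite /atomic_measure /msum /ms [RHS]big_enum_val.
by apply: eq_bigr => i _; rewrite valK.
Qed.

Lemma ge0_integral_atomic_measure (g : T -> \bar R) :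
  (forall x, 0 <= g x)%E -> measurable_fun [set: borel T] (g : borel T -> _) ->
  (\int[atomic_measure]_(x in [set: borel T]) g x = \sum_i (w i)%:E * g (a i))%E.
Proof.
move=> g0 mg; rewrite ge0_integral_measure_sum// [RHS]big_enum_val.
apply: eq_bigr => i _; rewrite /ms valK.
by rewrite ge0_integral_mscale// integral_dirac// diracT mul1e.
Qed.

End atomic.

Lemma bounded_on_compact (R : realType) (T : topologicalType) (g : T -> R) :
  compact [set: T] -> continuous g -> exists M, forall x, `|g x| <= M.
Proof.
move=> cT cg; have [M [Mr Mh]] :=
    compact_bounded (continuous_compact (continuous_subspaceT cg) cT).
(* [compact_bounded] only provides the bounds strictly above [M], hence [M + 1]. *)
exists (M + 1) => x; apply: (Mh (M + 1)); last by exists x.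
by rewrite ltrDl.
Qed.

Section atomic_integral.
Context (R : realType) (T : ptopologicalType) (I : finType).
Variables (w : I -> R) (w0 : forall i, 0 <= w i) (a : I -> T).
Variables (mu : Prob R T) (muwa : atomic mu w a).

Lemma ge0_integral_atomic (g : T -> \bar R) :
  (forall x, 0 <= g x)%E -> measurable_fun [set: borel T] (g : borel T -> _) ->
  (\int[mu]_(x in [set: borel T]) g x = \sum_i (w i)%:E * g (a i))%E.
Proof.
move=> g0 mg; rewrite -(ge0_integral_atomic_measure w0)//.
apply: eq_measure_integral => A mA _.
exact: etrans (muwa mA) (esym (atomic_measureE w0 a A)).
Qed.

Lemma Rintegral_atomic (g : T -> R) :
  measurable_fun [set: borel T] (g : borel T -> _) ->
  \int[mu]_(x in [set: borel T]) g x = \sum_i w i * g (a i).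
Proof.
move=> mg; rewrite /Rintegral integralE.
have mg' : measurable_fun [set: borel T] (EFin \o (g : borel T -> _)).
  exact/measurable_EFinP.
rewrite !ge0_integral_atomic//; [|exact: measurable_funeneg|exact: measurable_funepos].
under eq_bigr do rewrite funeposE -EFin_max.
under [X in (_ - X)%E]eq_bigr do rewrite funenegE -EFin_max.
rewrite !sumEFin /= -sumrB; apply: eq_bigr => i _.
rewrite -mulrBr; congr (_ * _).
rewrite /Order.max; case: ifPn => g1; case: ifPn => g2.
- by move: g2; rewrite oppr_lt0 ltNge (ltW g1).
- by rewrite sub0r opprK.
- by rewrite subr0.
- move: g1 g2; rewrite -!leNgt oppr_ge0 => g1 g2.
  have -> : g (a i) = 0 by apply/eqP; rewrite eq_le g1 g2.
  by rewrite oppr0 subr0.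
Qed.

End atomic_integral.

Section atomic_prob.
Context (R : realType) (T : ptopologicalType) (I : finType).
Variables (w : I -> R) (w0 : forall i, 0 <= w i) (a : I -> T).
Hypothesis w1 : \sum_i w i = 1.

Let setT1 : atomic_measure w0 a setT = 1%E.
Proof.
rewrite atomic_measureE (eq_bigr (fun i => (w i)%:E)) => [|i _].
  by rewrite sumEFin w1.
by rewrite diracT mule1.
Qed.

HB.instance Definition _ := Measure_isProbability.Build _ _ _
  (atomic_measure w0 a) setT1.

Lemma exists_atomic : exists mu : Prob R T, atomic mu w a.
Proof.
by exists (atomic_measure w0 a) => A _ /=; rewrite atomic_measureE.
Qed.

End atomic_prob.

Lemma uniform_atomic (R : realType) (T : ptopologicalType) n (n0 : (0 < n)%N)
    (a : 'I_n -> T) :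
  atomic (uniform_measure R n0 a) (fun=> n%:R^-1) a.
Proof. by move=> A _; rewrite -ge0_sume_distrr// => i _. Qed.

Section push.
Context (R : realType) (T T' : ptopologicalType).
Variables (f : T -> T') (mu : Prob R T).
Hypothesis mf : measurable_fun [set: borel T] (f : borel T -> borel T').

Lemma push_atomic (I : finType) (w : I -> R) (a : I -> T) :
  atomic mu w a -> atomic (push f mu) w (f \o a).
Proof.
move=> muwa A mA; rewrite pushE// muwa; first exact: eq_bigr.
by rewrite -[X in measurable X]setTI; exact: mf.
Qed.

Lemma ge0_integral_push (g : T' -> \bar R) :
  (forall x, 0 <= g x)%E -> measurable_fun [set: borel T'] (g : borel T' -> _) ->
  (\int[push f mu]_(x in [set: borel T']) g x =
   \int[mu]_(x in [set: borel T]) g (f x))%E.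
Proof.
move=> g0 mg.
rewrite (@eq_measure_integral _ _ _ _ (pushforward (mu : probability (borel T) R)
  (f : borel T -> borel T'))); last by move=> A mA _; exact: pushE.
by rewrite ge0_integral_pushforward ?preimage_setT.
Qed.

End push.

Lemma continuous_fst (T1 T2 : topologicalType) : continuous (@fst T1 T2).
Proof. by move=> x; exact: (@cvg_fst _ _ (nbhs x.1) (nbhs x.2)). Qed.

Lemma continuous_snd (T1 T2 : topologicalType) : continuous (@snd T1 T2).
Proof. by move=> x; exact: (@cvg_snd _ _ (nbhs x.1) (nbhs x.2)). Qed.

(** The map [x |-> (x, point)] is continuous and pulls the cylinder back to its base. In
    [exact_coupling], a Borel cylinder thus has a Borel base, on which the marginals of [g] are
    known. *)
Lemma measurable_preimage_fst (T1 T2 : ptopologicalType) (A : set T1) :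
  measurable (fst @^-1` A : set (borel (T1 * T2)%type)) ->
  measurable (A : set (borel T1)).
Proof.
move=> mA; have c : continuous (fun x : T1 => (x, point) : T1 * T2).
  by move=> x; apply: cvg_pair; [exact: cvg_id|exact: cvg_cst].
by have := continuous_borel c measurableT mA; rewrite setTI.
Qed.

Lemma measurable_preimage_snd (T1 T2 : ptopologicalType) (A : set T2) :
  measurable (snd @^-1` A : set (borel (T1 * T2)%type)) ->
  measurable (A : set (borel T2)).
Proof.
move=> mA; have c : continuous (fun x : T2 => (point, x) : T1 * T2).
  by move=> x; apply: cvg_pair; [exact: cvg_cst|exact: cvg_id].
by have := continuous_borel c measurableT mA; rewrite setTI.
Qed.

(* Changing the values of [g] on non-Borel sets turns it into an element of [Prob]
   whose marginals are exactly [P] and [Q], including on non-Borel sets. *)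
Section exact_coupling.
Context (R : realType) (T1 T2 : ptopologicalType).
Variables (P : Prob R T1) (Q : Prob R T2) (g : Prob R (T1 * T2)%type).
Hypothesis gP : forall A : set (borel T1), measurable A ->
  (push fst g : probability (borel T1) R) A = (P : probability (borel T1) R) A.
Hypothesis gQ : forall A : set (borel T2), measurable A ->
  (push snd g : probability (borel T2) R) A = (Q : probability (borel T2) R) A.

(** Additivity is tested on Borel sets only, so any nonnegative values are allowed elsewhere. A
    non-Borel cylinder over the first factor gets the [P]-value of its base; every other non-Borel
    set gets the [Q]-value of its second projection. *)
Let m (C : set (borel (T1 * T2)%type)) : \bar R :=
  if pselect (measurable C) then (g : probability (borel _) R) C
  else if pselect (fst @^-1` (fst @` C) = C) then
    (P : probability (borel T1) R) (fst @` C)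
  else (Q : probability (borel T2) R) (snd @` C).

Let mE C : measurable C -> m C = (g : probability (borel _) R) C.
Proof. by rewrite /m; case: pselect. Qed.

Let m0 : m set0 = 0%E. Proof. by rewrite mE. Qed.

Let m_ge0 A : (0 <= m A)%E.
Proof.
by rewrite /m; case: (pselect (measurable A)) => ?;
  [|case: (pselect (_ = A)) => ?]; exact: measure_ge0.
Qed.

Let m_sigma_additive : semi_sigma_additive m.
Proof.
move=> F mF tF mUF; rewrite mE//.
under eq_fun do under eq_bigr do rewrite mE//.
exact: (@measure_semi_sigma_additive _ _ _ (g : probability (borel _) R)).
Qed.

HB.instance Definition _ := isMeasure.Build _ _ _ m m0 m_ge0 m_sigma_additive.

Let m_setT : m setT = 1%E. Proof. by rewrite mE// probability_setT. Qed.

HB.instance Definition _ := Measure_isProbability.Build _ _ _ m m_setT.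

Lemma exact_coupling : exists pi : Prob R (T1 * T2)%type,
  [/\ push fst pi = P, push snd pi = Q &
      forall A : set (borel (T1 * T2)%type), measurable A ->
        (pi : probability (borel _) R) A = (g : probability (borel _) R) A].
Proof.
have fstK (A : set T1) : fst @` (fst @^-1` A : set (T1 * T2)) = A.
  by apply/seteqP; split => [x [z Az <-]//|x Ax]; exists (x, point).
have sndK (A : set T2) : snd @` (snd @^-1` A : set (T1 * T2)) = A.
  by apply/seteqP; split => [x [z Az <-]//|x Ax]; exists (point, x).
exists m; split; last exact: mE.
- apply: eq_Prob => A; rewrite pushE /=; last first.
    by apply: continuous_borel; exact: continuous_fst.
  rewrite /m; case: pselect => mA.
    have mA' := measurable_preimage_fst mA.
    rewrite -(gP mA').
    by rewrite pushE//; apply: continuous_borel; exact: continuous_fst.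
  by rewrite fstK; case: pselect.
- apply: eq_Prob => A; rewrite pushE /=; last first.
    by apply: continuous_borel; exact: continuous_snd.
  rewrite /m; case: pselect => mA.
    have mA' := measurable_preimage_snd mA.
    rewrite -(gQ mA').
    by rewrite pushE//; apply: continuous_borel; exact: continuous_snd.
  case: pselect => [E|]; last by rewrite sndK.
  (* The two prescriptions cannot clash: a set that is a cylinder over both factors is empty or the
     whole space, hence Borel. *)
  exfalso; have [A0|/set0P[y Ay]] := eqVneq A set0.
    by apply: mA; rewrite A0 preimage_set0.
  apply: mA; rewrite (_ : A = setT) ?preimage_setT//.
  apply/seteqP; split => // y' _.
  have : (fst @^-1` (fst @` (snd @^-1` A))) ((point, y') : T1 * T2) by exists (point, y).
  by rewrite E.
Qed.

End exact_coupling.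

(** * Token measures *)

Section compact_integral.
Context (R : realType) (T : ptopologicalType) (mu : Prob R T).
Hypothesis cT : compact [set: T].
Implicit Types f g : T -> R.

Lemma EFin_Rintegral_continuous f : continuous f ->
  (\int[mu]_(x in [set: borel T]) (f x)%:E)%E =
  (\int[mu]_(x in [set: borel T]) f x)%:E.
Proof.
move=> cf; rewrite /Rintegral fineK//.
by apply: integrable_fin_num => //; exact: (prob_integrable mu cT cf).
Qed.

Lemma RintegralD_continuous f g : continuous f -> continuous g ->
  \int[mu]_(x in [set: borel T]) (f x + g x) =
  \int[mu]_(x in [set: borel T]) f x + \int[mu]_(x in [set: borel T]) g x.
Proof. by move=> cf cg; rewrite RintegralD//; exact: prob_integrable. Qed.

Lemma RintegralZ_continuous f c : continuous f ->
  \int[mu]_(x in [set: borel T]) (c * f x) =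
  c * \int[mu]_(x in [set: borel T]) f x.
Proof. by move=> cf; rewrite RintegralZl//; exact: prob_integrable. Qed.

Lemma Rintegral_cst_prob (c : R) : \int[mu]_(x in [set: borel T]) c = c.
Proof.
rewrite Rintegral_cst// [X in fine X](_ : _ = 1%E) ?mulr1//.
exact: (probability_setT (mu : probability (borel T) R)).
Qed.

Lemma Rintegral_sum_continuous (I : Type) (s : seq I) (f : I -> T -> R) :
  (forall i, continuous (f i)) ->
  \int[mu]_(x in [set: borel T]) (\sum_(i <- s) f i x) =
  \sum_(i <- s) \int[mu]_(x in [set: borel T]) f i x.
Proof.
move=> cf; elim: s => [|i s IH].
  rewrite big_nil -[RHS]Rintegral_cst_prob.
  by apply: eq_Rintegral => x _; rewrite big_nil.
rewrite big_cons -IH -RintegralD_continuous//; last exact: continuous_sum.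
by apply: eq_Rintegral => x _; rewrite big_cons.
Qed.

End compact_integral.

Section enorm.
Context (R : realType) (n : nat).
Implicit Types x y : 'cV[R]_n.

Lemma sqr_enorm x : enorm x ^+ 2 = \sum_i x i 0 ^+ 2.
Proof. by rewrite sqr_sqrtr//; apply: sumr_ge0 => i _; exact: sqr_ge0. Qed.

Lemma sqr_enorm_eq0 x : enorm x ^+ 2 = 0 -> x = 0.
Proof.
move=> x0; apply/colP => i; rewrite mxE; apply/eqP.
rewrite -normr_eq0 eq_le normr_ge0 andbT (le_trans (enorm_coord x i))//.
by move/eqP : x0; rewrite sqrf_eq0 => /eqP ->.
Qed.

Lemma sqr_enormB x y : enorm (x - y) ^+ 2 =
  enorm x ^+ 2 - 2 * (\sum_i y i 0 * x i 0) + enorm y ^+ 2.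
Proof.
rewrite !sqr_enorm mulr_sumr -sumrB -big_split/=; apply: eq_bigr => i _.
by rewrite !mxE; ring.
Qed.

End enorm.

Section continuous_arith.
Context (R : realType) (T : topologicalType).
Implicit Types f g : T -> R.

Lemma continuous_add f g :
  continuous f -> continuous g -> continuous (fun t => f t + g t).
Proof. by move=> cf cg t; exact: (cvgD (cf t) (cg t)). Qed.

Lemma continuous_sub f g :
  continuous f -> continuous g -> continuous (fun t => f t - g t).
Proof. by move=> cf cg t; exact: (cvgB (cf t) (cg t)). Qed.

Lemma continuous_mul f g :
  continuous f -> continuous g -> continuous (fun t => f t * g t).
Proof. by move=> cf cg t; exact: (cvgM (cf t) (cg t)). Qed.

Lemma continuous_sqr f : continuous f -> continuous (fun t => f t ^+ 2).
Proof. by move=> cf t; exact: (cvgM (cf t) (cf t)). Qed.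

Lemma continuous_norm f : continuous f -> continuous (fun t => `|f t|).
Proof. by move=> cf t; exact: cvg_norm (cf t). Qed.

End continuous_arith.

Section state.
Context (R : realType) (N d : nat) (N0 : (0 < N)%N).
Context (S : set 'cV[R]_d) (S0 : S !=set0).
Local Notation X := (state N0 S0).
Implicit Types (x : 'I_N -> 'cV[R]_d) (y : 'I_N -> subT S0) (z : X).

Definition atom y (i : 'I_N) : X :=
  (SigSub (mem_set (PE_ord R i)) : subT (PE_neq0 R N0), y i).

Definition is_tokens (mu : Prob R X) y := atomic mu (fun=> N%:R^-1) (atom y).

Lemma tokens_is_tokens y : is_tokens (tokens N0 y) y.
Proof. exact: uniform_atomic. Qed.

(* On the finite set [PE_N] the tent function is the indicator of [p_i]. *)
Definition tent (i : 'I_N) z : R :=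
  Num.max 0 (1 - N%:R * `|val z.1 - i.+1%:R / N%:R|).

Lemma labelP z : exists i : 'I_N, val z.1 = i.+1%:R / N%:R :> R.
Proof. exact: set_mem (valP z.1). Qed.

(** Distinct labels are at least 1/N apart, and a tent of height 1 and slope [N] has reached 0 at
    that distance. *)
Lemma tentE (i j : 'I_N) z : val z.1 = j.+1%:R / N%:R :> R ->
  tent i z = (i == j)%:R.
Proof.
have NR : 0 < N%:R :> R by rewrite ltr0n.
move=> zj; rewrite /tent zj; have [->|ij] := eqVneq i j.
  by rewrite subrr normr0 mulr0 subr0; apply/max_idPr.
apply/max_idPl; rewrite subr_le0 -mulrBl normrM (gtr0_norm (x := _^-1)) ?invr_gt0//.
rewrite mulrCA divff ?gt_eqF// mulr1.
have := ij; rewrite neq_ltn => /orP[] lij.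
  by rewrite ger0_norm ?subr_ge0 ?ler_nat 1?ltnW// -natrB 1?ltnW// ler1n subn_gt0.
by rewrite ler0_norm ?subr_le0 ?ler_nat 1?ltnW// opprB -natrB 1?ltnW// ler1n subn_gt0.
Qed.

Lemma tent_atom (i j : 'I_N) y : tent i (atom y j) = (i == j)%:R.
Proof. exact: tentE. Qed.

Lemma tent_ge0 i z : 0 <= tent i z.
Proof. by rewrite le_max lexx. Qed.

Lemma sum_tent_mul (F : 'I_N -> R) (j : 'I_N) z :
  val z.1 = j.+1%:R / N%:R :> R -> \sum_i tent i z * F i = F j.
Proof.
move=> zj; rewrite (bigD1 j)//= (tentE _ zj) eqxx mul1r big1 ?addr0// => i ij.
by rewrite (tentE _ zj) (negbTE ij) mul0r.
Qed.

Lemma sum_tent z : \sum_i tent i z = 1.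
Proof.
have [j zj] := labelP z; rewrite -[RHS](sum_tent_mul (fun=> 1) zj).
by apply: eq_bigr => i _; rewrite mulr1.
Qed.

Lemma tent_continuous i : continuous (tent i).
Proof.
move=> z; apply: (@continuous_comp _ _ _ (fun z : X => val z.1)
  (fun p : R => Num.max 0 (1 - N%:R * `|p - i.+1%:R / N%:R|))).
  apply: (@continuous_comp X _ _ fst (val : subT (PE_neq0 R N0) -> R)).
    exact: continuous_fst.
  exact: continuous_val.
apply: (@continuous_max _ _ (fun=> 0)); first exact: cst_continuous.
apply: cvgB; first exact: cvg_cst.
apply: cvgM; first exact: cvg_cst.
apply: cvg_norm; apply: cvgB; [exact: cvg_id|exact: cvg_cst].
Qed.

Lemma position_continuous : continuous (fun z : X => val z.2).
Proof.
move=> z; apply: (@continuous_comp X _ _ snd (val : subT S0 -> _)).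
  exact: continuous_snd.
exact: continuous_val.
Qed.

Lemma compact_state : compact S -> compact [set: X].
Proof.
move=> cS; have -> : [set: X] = [set: subT (PE_neq0 R N0)] `*` [set: subT S0].
  by apply/seteqP; split.
apply: compact_setX; last exact: compact_sub.
apply: compact_sub; apply: finite_compact.
rewrite (_ : PE R N = [set i.+1%:R / N%:R | i in [set: 'I_N]]).
  exact/finite_image/finite_finset.
by apply/seteqP; split => [p [i ->]|p [i _ <-]]; exists i.
Qed.

(** Since exactly one tent equals 1 at [z], this is the squared distance from the position of [z] to
    the point that [x] assigns to the slice of [z]. It is continuous, and it vanishes only where the
    position is that point. *)
Definition dev x z := \sum_i tent i z * enorm (val z.2 - x i) ^+ 2.

Lemma dev_ge0 x z : 0 <= dev x z.
Proof. by apply: sumr_ge0 => i _; rewrite mulr_ge0 ?tent_ge0 ?sqr_ge0. Qed.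

Lemma dev_eq0 x z (j : 'I_N) : val z.1 = j.+1%:R / N%:R :> R ->
  dev x z = 0 -> val z.2 = x j.
Proof.
move=> zj; rewrite /dev (sum_tent_mul (fun i => enorm (val z.2 - x i) ^+ 2) zj).
by move=> /sqr_enorm_eq0 /eqP; rewrite subr_eq0 => /eqP.
Qed.

Lemma dev_atom y i : dev (fun i => val (y i)) (atom y i) = 0.
Proof.
rewrite /dev (@sum_tent_mul _ i)//= subrr -(scale0r 0) sqr_enorm big1// => k _.
by rewrite !mxE mul0r expr0n.
Qed.

Lemma dev_continuous x : continuous (dev x).
Proof.
apply: continuous_sum => i z; apply: cvgM; first exact: tent_continuous.
move: z; apply: continuous_sqr; apply: enorm_continuous => z.
by apply: cvgB; [exact: position_continuous|exact: cvg_cst].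
Qed.

End state.

Section recover.
Context (R : realType) (N d : nat) (N0 : (0 < N)%N).
Context (S : set 'cV[R]_d) (S0 : S !=set0) (cS : compact S).
Local Notation X := (state N0 S0).
Local Notation tent := (@tent R N d N0 S S0).
Implicit Types (mu : Prob R X) (y : 'I_N -> subT S0) (z : X).

Let cX : compact [set: X] := compact_state cS.

(** Normalizing by [N] rather than by the mass of the slice keeps this weakly continuous for all
    [mu], even where that mass vanishes. It is the barycenter of the slice when the mass is 1/N. *)
Definition bar mu (i : 'I_N) : 'cV[R]_d :=
  \col_k (N%:R * \int[mu]_(z in [set: borel X]) (tent i z * val z.2 k 0)).

(* When the i-th slice has mass 1/N, the second term is the absolute value of
   1/N times the variance of the normalized slice. *)
Definition defect mu : R := \sum_i
  (`|\int[mu]_(z in [set: borel X]) tent i z - N%:R^-1| +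
   `|\int[mu]_(z in [set: borel X]) (tent i z * enorm (val z.2) ^+ 2) -
     N%:R^-1 * enorm (bar mu i) ^+ 2|).

Let NR : N%:R != 0 :> R. Proof. by rewrite pnatr_eq0 -lt0n. Qed.

Let ct i : continuous (tent i). Proof. exact: tent_continuous. Qed.

Let ctx i k : continuous (fun z => tent i z * val z.2 k 0).
Proof.
move=> z; apply: cvgM; first exact: ct.
by move: z; apply: coordC; exact: position_continuous.
Qed.

Let ctn i : continuous (fun z => tent i z * enorm (val z.2) ^+ 2).
Proof.
move=> z; apply: cvgM; first exact: ct.
by move: z; apply: continuous_sqr; apply: enorm_continuous; exact: position_continuous.
Qed.

Lemma Rintegral_tokens mu y (g : X -> R) : continuous g -> is_tokens mu y ->
  \int[mu]_(z in [set: borel X]) g z = N%:R^-1 * \sum_i g (atom N0 y i).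
Proof.
move=> cg my; rewrite mulr_sumr; apply: (Rintegral_atomic _ my).
  by move=> i; rewrite invr_ge0.
exact: continuous_borel_real.
Qed.

Lemma Rintegral_tent_tokens mu y i (g : X -> R) :
  continuous (fun z => tent i z * g z) -> is_tokens mu y ->
  \int[mu]_(z in [set: borel X]) (tent i z * g z) = N%:R^-1 * g (atom N0 y i).
Proof.
move=> cg my; rewrite (Rintegral_tokens cg my) (bigD1 i)//= tent_atom eqxx mul1r.
by rewrite big1 ?addr0// => j ji; rewrite tent_atom eq_sym (negbTE ji) mul0r.
Qed.

Lemma bar_tokens mu y i : is_tokens mu y -> bar mu i = val (y i).
Proof.
move=> my; apply/colP => k; rewrite mxE (Rintegral_tent_tokens (@ctx i k) my).
by rewrite mulrA divff// mul1r.
Qed.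

Lemma Rintegral_tent mu y i : is_tokens mu y ->
  \int[mu]_(z in [set: borel X]) tent i z = N%:R^-1.
Proof.
move=> my; rewrite -[RHS]mulr1 -(@Rintegral_tent_tokens mu y i (fun=> 1))//.
  by apply: eq_Rintegral => z _; rewrite mulr1.
by under eq_fun do rewrite mulr1; exact: ct.
Qed.

Lemma defect_tokens mu y : is_tokens mu y -> defect mu = 0.
Proof.
move=> my; rewrite /defect big1// => i _.
rewrite (Rintegral_tent i my) (Rintegral_tent_tokens (@ctn i) my) (bar_tokens i my).
by rewrite !subrr normr0 addr0.
Qed.

Lemma defect_ge0 mu : 0 <= defect mu.
Proof. by apply: sumr_ge0 => i _; rewrite addr_ge0. Qed.

Lemma bar_coord_continuous i k : continuous (fun mu => bar mu i k 0).
Proof.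
under eq_fun do rewrite mxE.
apply: continuous_mul; first exact: cst_continuous.
apply: integral_Prob_continuous; first exact: ctx.
exact: bounded_on_compact (@ctx i k).
Qed.

Lemma bar_continuous i : continuous (fun mu => bar mu i).
Proof. by apply: continuous_mx => k j; rewrite (ord1 j); exact: bar_coord_continuous. Qed.

Lemma defect_continuous : continuous defect.
Proof.
apply: continuous_sum => i.
apply: continuous_add; apply: continuous_norm; apply: continuous_sub.
- apply: integral_Prob_continuous; first exact: ct.
  exact: bounded_on_compact (@ct i).
- exact: cst_continuous.
- apply: integral_Prob_continuous; first exact: ctn.
  exact: bounded_on_compact (@ctn i).
- apply: continuous_mul; first exact: cst_continuous.
  by apply: continuous_sqr; apply: enorm_continuous; exact: bar_continuous.
Qed.

(** Expand the square. Write b for [bar mu i]: slice [i] has mass 1/N and second moment |b|^2/N by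
    the vanishing defect, and first moment b/N by definition of [bar], so its contribution is (|b|^2
    - 2|b|^2 + |b|^2)/N = 0. *)
Lemma Rintegral_dev_bar mu : defect mu = 0 ->
  \int[mu]_(z in [set: borel X]) dev (bar mu) z = 0.
Proof.
move=> /eqP; rewrite psumr_eq0; last by move=> i _; rewrite addr_ge0.
move=> /allP h.
have {h} [m1 m2] : (forall i, \int[mu]_(z in [set: borel X]) tent i z = N%:R^-1) /\
    (forall i, \int[mu]_(z in [set: borel X]) (tent i z * enorm (val z.2) ^+ 2) =
     N%:R^-1 * enorm (bar mu i) ^+ 2).
  by split => i; have /= := h i (mem_index_enum i); rewrite paddr_eq0// !normr_eq0
    !subr_eq0 => /andP[/eqP a /eqP b].
have devE z : dev (bar mu) z = \sum_i (tent i z * enorm (val z.2) ^+ 2 +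
    (\sum_k (- 2 * bar mu i k 0) * (tent i z * val z.2 k 0) +
     enorm (bar mu i) ^+ 2 * tent i z)).
  apply: eq_bigr => i _; rewrite sqr_enormB addrA mulrDr mulrBr.
  rewrite [in RHS](mulrC _ (tent i z)); congr (_ + _ + _).
  rewrite mulrCA -mulNr !mulr_sumr; apply: eq_bigr => k _; ring.
have c1 i k : continuous (fun z => - 2 * bar mu i k 0 * (tent i z * val z.2 k 0)).
  by move=> z; apply: cvgM; [exact: cvg_cst|exact: ctx].
have c2 i : continuous (fun z => enorm (bar mu i) ^+ 2 * tent i z).
  by move=> z; apply: cvgM; [exact: cvg_cst|exact: ct].
have c3 i : continuous (fun z => \sum_k - 2 * bar mu i k 0 * (tent i z * val z.2 k 0)).
  exact: continuous_sum.
have c4 i : continuous (fun z => \sum_k - 2 * bar mu i k 0 * (tent i z * val z.2 k 0)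
    + enorm (bar mu i) ^+ 2 * tent i z).
  by move=> z; apply: cvgD; [exact: c3|exact: c2].
under eq_Rintegral do rewrite devE.
rewrite (Rintegral_sum_continuous mu cX); last first.
  by move=> i z; apply: cvgD; [exact: ctn|exact: c4].
rewrite big1// => i _; rewrite (RintegralD_continuous mu cX)//.
rewrite (RintegralD_continuous mu cX)// (Rintegral_sum_continuous mu cX)//.
under eq_bigr do rewrite (RintegralZ_continuous mu cX)//.
rewrite (RintegralZ_continuous mu cX)// m1 m2.
have -> : \sum_k - 2 * bar mu i k 0 *
      \int[mu]_(z in [set: borel X]) (tent i z * val z.2 k 0) =
    - 2 * (N%:R^-1 * enorm (bar mu i) ^+ 2).
  rewrite sqr_enorm !mulr_sumr; apply: eq_bigr => k _.
  rewrite -mulrA; congr (_ * _); rewrite expr2 mulrA [in RHS]mxE.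
  by rewrite [N%:R^-1 * (_ * _)]mulrA mulVf// mul1r mxE; ring.
by ring.
Qed.

Lemma integral_off_dev mu (x : 'I_N -> 'cV[R]_d) (f g : X -> \bar R) :
  \int[mu]_(z in [set: borel X]) dev x z = 0 ->
  (forall z, 0 <= f z)%E -> (forall z, 0 <= g z)%E ->
  (forall z, dev x z = 0 -> f z = g z) ->
  (\int[mu]_(z in [set: borel X]) f z = \int[mu]_(z in [set: borel X]) g z)%E.
Proof.
move=> i0 f0 g0 fg.
apply: (@eq_integral_off_null _ (borel X) R mu (fun z => (dev x z)%:E)) => //.
- apply/measurable_EFinP; apply: continuous_borel_real; exact: dev_continuous.
- by move=> z; rewrite lee_fin dev_ge0.
- rewrite (EFin_Rintegral_continuous mu cX) ?i0//; exact: dev_continuous.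
- by move=> z [/fg].
Qed.

(** The nonnegative function [dev (bar mu)] has integral zero, so [mu] is concentrated where the
    position is the barycenter of the slice; the slice masses then determine [mu] on Borel sets. *)
Lemma defect0_tokens mu : defect mu = 0 ->
  exists2 y, is_tokens mu y & forall i, val (y i) = bar mu i.
Proof.
move=> mu0; have dev0 := Rintegral_dev_bar mu0.
have m1 i : \int[mu]_(z in [set: borel X]) tent i z = N%:R^-1.
  move/eqP: mu0; rewrite psumr_eq0; last by move=> j _; rewrite addr_ge0.
  move=> /allP/(_ i (mem_index_enum i))/=.
  by rewrite paddr_eq0// !normr_eq0 !subr_eq0 => /andP[/eqP].
(* If no point of [S] were the barycenter, [tent i] would vanish wherever [dev] does, and the slice
   would have mass 0 instead of 1/N. *)
have ex i : exists s : subT S0, val s = bar mu i.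
  apply: contrapT => nex.
  have : (\int[mu]_(z in [set: borel X]) (tent i z)%:E =
      \int[mu]_(z in [set: borel X]) 0)%E.
    apply: (integral_off_dev dev0) => // z; first by rewrite lee_fin tent_ge0.
    move=> dz; have [j zj] := labelP z; rewrite (tentE _ zj).
    case: eqP => // ij; exfalso; apply: nex; exists z.2.
    by rewrite ij; exact: dev_eq0 dz.
  rewrite integral0 (EFin_Rintegral_continuous mu cX (@ct i)) m1.
  by move=> [] /eqP; rewrite invr_eq0 (negbTE NR).
have [y yE] := choice ex; exists y => // A mA.
rewrite -[A in LHS]setIT -integral_indic//.
(* Where [dev] vanishes, the indicator of [A] equals the combination of tents with its values at the
   atoms as coefficients; the latter integrates to the sum of the atomic masses. *)
rewrite (integral_off_dev (g := fun z =>
    (\sum_i tent i z * \1_A (atom N0 y i : borel X))%:E) dev0).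
- rewrite (EFin_Rintegral_continuous mu cX); last first.
    apply: continuous_sum => i z; apply: cvgM; [exact: ct|exact: cvg_cst].
  rewrite (Rintegral_sum_continuous mu cX); last first.
    by move=> i z; apply: cvgM; [exact: ct|exact: cvg_cst].
  rewrite -sumEFin; apply: eq_bigr => i _.
  under eq_Rintegral do rewrite mulrC.
  by rewrite (RintegralZ_continuous mu cX)// m1 diracE indicE -EFinM mulrC.
- by move=> z; rewrite lee_fin indicE.
- by move=> z; rewrite lee_fin; apply: sumr_ge0 => i _; rewrite mulr_ge0 ?tent_ge0 ?indicE.
move=> z dz; have [j zj] := labelP z.
rewrite (sum_tent_mul (fun i => \1_A (atom N0 y i : borel X)) zj).
congr (\1_A _)%:E; rewrite [z]surjective_pairing /atom; congr (_, _).
  by apply: val_inj.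
by apply: val_inj; rewrite yE; exact: dev_eq0 dz.
Qed.

End recover.

(** * Discrete optimal transport *)

Section discrete_transport.
Context (R : realType) (N : nat) (N0 : (0 < N)%N).
Implicit Types a c : 'I_N -> 'I_N -> R.

Definition plans : set ('I_N -> 'I_N -> R) :=
  [set a | [/\ forall i j, 0 <= a i j, forall i, \sum_j a i j = N%:R^-1 &
               forall j, \sum_i a i j = N%:R^-1]].

Definition plan_cost c a := \sum_i \sum_j a i j * c i j.

Definition transport c : R := inf [set plan_cost c a | a in plans].

Let NR : N%:R != 0 :> R. Proof. by rewrite pnatr_eq0 -lt0n. Qed.

Lemma sum_invN : \sum_(i < N) (N%:R^-1 : R) = 1.
Proof. by rewrite sumr_const card_ord -(mulr_natr N%:R^-1) mulVf. Qed.

(** The witness is the product plan. Nonemptiness matters because [inf] of the empty set is a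
    default value, about which lower bounds say nothing. *)
Lemma plans_neq0 : plans !=set0.
Proof.
exists (fun _ _ => N%:R^-1 * N%:R^-1); split => [i j|i|j].
- by rewrite mulr_ge0.
- by rewrite -mulr_sumr sum_invN mulr1.
- by rewrite -mulr_sumr sum_invN mulr1.
Qed.

Lemma plan_cost_ge0 c a : (forall i j, 0 <= c i j) -> plans a -> 0 <= plan_cost c a.
Proof.
by move=> c0 [a0 _ _]; do 2 (apply: sumr_ge0 => ? _); rewrite mulr_ge0.
Qed.

Lemma transport_le c a : (forall i j, 0 <= c i j) -> plans a ->
  transport c <= plan_cost c a.
Proof.
move=> c0 pa; apply: ge_inf; last by exists a.
by exists 0 => _ [b pb <-]; exact: plan_cost_ge0.
Qed.

Lemma le_transport c x : (forall a, plans a -> x <= plan_cost c a) -> x <= transport c.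
Proof.
move=> h; apply: lb_le_inf; last by move=> _ [a pa <-]; exact: h.
by have [a pa] := plans_neq0; exists (plan_cost c a), a.
Qed.

Lemma transport_ge0 c : (forall i j, 0 <= c i j) -> 0 <= transport c.
Proof. by move=> c0; apply: le_transport => a; exact: plan_cost_ge0. Qed.

(** Every plan has total mass 1, so raising all costs by [e] raises each plan cost by [e]. Used in
    both directions, this gives the continuity of [transport] in the cost matrix. *)
Lemma transport_perturb c c' e : (forall i j, 0 <= c' i j) ->
  (forall i j, c' i j <= c i j + e) -> transport c' <= transport c + e.
Proof.
move=> c'0 cc'; rewrite -lerBlDr; apply: le_transport => a pa; rewrite lerBlDr.
apply: le_trans (transport_le c'0 pa) _; have [a0 a1 _] := pa.
apply: (@le_trans _ _ (\sum_i \sum_j (a i j * c i j + e * a i j))).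
  do 2 (apply: ler_sum => ? _).
  by rewrite (mulrC e) -mulrDr ler_wpM2l.
under eq_bigr do rewrite big_split/= -mulr_sumr a1.
by rewrite big_split/= -mulr_sumr sum_invN mulr1.
Qed.

Lemma transport_continuous (T : topologicalType) (c : T -> 'I_N -> 'I_N -> R) :
  (forall t i j, 0 <= c t i j) -> (forall i j, continuous (fun t => c t i j)) ->
  continuous (fun t => transport (c t)).
Proof.
move=> c0 cc t; apply/(@cvgrPdist_le _ _ _ (nbhs t)) => e e0.
near=> s.
have h : forall ij : 'I_N * 'I_N, `|c t ij.1 ij.2 - c s ij.1 ij.2| <= e.
  near: s; apply: filter_forall => -[i j] /=.
  by have /(@cvgrPdist_le _ _ _ (nbhs t)) := cc i j t; exact.
rewrite ler_distl; apply/andP; split.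
  rewrite lerBlDr; apply: transport_perturb => // i j.
  by have := h (i, j); rewrite ler_distl lerBlDr => /andP[].
by apply: transport_perturb => // i j; have := h (i, j); rewrite ler_distl => /andP[].
Unshelve. all: by end_near. Qed.

End discrete_transport.

Section transport_tokens.
Context (R : realType) (N d : nat) (N0 : (0 < N)%N) (lambda : R).
Context (S : set 'cV[R]_d) (S0 : S !=set0) (cS : compact S) (l0 : 0 <= lambda).
Local Notation X := (state N0 S0).

Definition token_cost (x x' : 'I_N -> 'cV[R]_d) (i j : 'I_N) : R :=
  enorm (x i - x' j) ^+ 2 + lambda * `|i.+1%:R / N%:R - j.+1%:R / N%:R| ^+ 2.

Lemma token_cost_ge0 x x' i j : 0 <= token_cost x x' i j.
Proof. by apply: addr_ge0; [exact: sqr_ge0|apply: mulr_ge0 => //; exact: sqr_ge0]. Qed.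

Lemma cost_ge0 (z w : X) : 0 <= cost lambda z w.
Proof. by apply: addr_ge0; [exact: sqr_ge0|apply: mulr_ge0 => //; exact: sqr_ge0]. Qed.

Lemma cost_continuous : continuous (fun zw : X * X => cost lambda zw.1 zw.2).
Proof.
have c1 : continuous (fun zw : X * X => val zw.1.1).
  move=> zw; apply: (@continuous_comp _ _ _ (fun zw : X * X => zw.1.1)
    (val : subT (PE_neq0 R N0) -> R)); last exact: continuous_val.
  by apply: (@continuous_comp _ _ _ fst fst); exact: continuous_fst.
have c2 : continuous (fun zw : X * X => val zw.2.1).
  move=> zw; apply: (@continuous_comp _ _ _ (fun zw : X * X => zw.2.1)
    (val : subT (PE_neq0 R N0) -> R)); last exact: continuous_val.
  apply: (@continuous_comp _ _ _ snd fst); first exact: continuous_snd.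
  exact: continuous_fst.
have c3 : continuous (fun zw : X * X => val zw.1.2).
  move=> zw; apply: (@continuous_comp _ _ _ fst (fun z : X => val z.2)).
    exact: continuous_fst.
  exact: position_continuous.
have c4 : continuous (fun zw : X * X => val zw.2.2).
  move=> zw; apply: (@continuous_comp _ _ _ snd (fun z : X => val z.2)).
    exact: continuous_snd.
  exact: position_continuous.
apply: continuous_add.
  apply: continuous_sqr; apply: enorm_continuous => zw.
  exact: (cvgB (c3 zw) (c4 zw)).
apply: continuous_mul; first exact: cst_continuous.
by apply: continuous_sqr; apply: continuous_norm; exact: continuous_sub.
Qed.

Variables (P Q : Prob R X) (y y' : 'I_N -> subT S0).
Hypotheses (Py : is_tokens P y) (Qy' : is_tokens Q y').
Local Notation x := (fun i => val (y i)).
Local Notation x' := (fun i => val (y' i)).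

Let cX : compact [set: X] := compact_state cS.

Let cXX : compact [set: X * X].
Proof.
have -> : [set: X * X] = [set: X] `*` [set: X] by apply/seteqP; split.
exact: compact_setX.
Qed.

(** Weights [a] on the pairs of atoms give a measure whose marginals match [P] and [Q] on Borel sets
    only; [exact_coupling] turns it into an element of [couplings] without changing the integral. *)
Lemma plan_coupling a : plans a -> exists2 pi, couplings P Q pi &
  (\int[pi]_(zw in [set: borel (X * X)%type]) (cost lambda zw.1 zw.2)%:E =
   (plan_cost (token_cost x x') a)%:E)%E.
Proof.
move=> [a0 a1 a2].
have sa : \sum_ij a ij.1 ij.2 = 1.
  by rewrite -(pair_bigA _ a)/= (eq_bigr (fun=> N%:R^-1)) ?sum_invN.
have [g gE] := @exists_atomic R (X * X)%type ('I_N * 'I_N)%type (fun ij => a ij.1 ij.2)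
  (fun ij => a0 ij.1 ij.2) (fun ij => (atom N0 y ij.1, atom N0 y' ij.2)) sa.
have [||pi [piP piQ pig]] := @exact_coupling R X X P Q g.
- move=> A mA; rewrite (push_atomic (continuous_borel (@continuous_fst X X)) gE mA).
  rewrite Py// -(pair_bigA _ (fun i j => (a i j)%:E * \d_(atom N0 y i : borel X) A)%E).
  apply: eq_bigr => i _; rewrite -(a1 i) -sumEFin ge0_sume_distrl// => j _.
  by rewrite lee_fin.
- move=> A mA; rewrite (push_atomic (continuous_borel (@continuous_snd X X)) gE mA).
  rewrite Qy'// -(pair_bigA _ (fun i j => (a i j)%:E * \d_(atom N0 y' j : borel X) A)%E).
  rewrite exchange_big; apply: eq_bigr => i _; rewrite -(a2 i) -sumEFin.
  by rewrite ge0_sume_distrl// => j _; rewrite lee_fin.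
exists pi => //.
rewrite (@eq_measure_integral _ _ _ _ (g : probability (borel (X * X)%type) R)); last first.
  by move=> A mA _; exact: pig.
rewrite (EFin_Rintegral_continuous g cXX cost_continuous); congr EFin.
rewrite (Rintegral_atomic (fun ij => a0 ij.1 ij.2) gE); last first.
  exact: continuous_borel_real cost_continuous.
by rewrite -(pair_bigA _ (fun i j => a i j * token_cost x x' i j)).
Qed.

(** The plan records the [pi]-mass of each product of slices, written as the integral of a product
    of tents. As the tents sum to 1, its row and column sums reduce to integrals against the
    marginals. *)
Lemma coupling_plan pi : couplings P Q pi -> exists2 a, plans a &
  (\int[pi]_(zw in [set: borel (X * X)%type]) (cost lambda zw.1 zw.2)%:E =
   (plan_cost (token_cost x x') a)%:E)%E.
Proof.
move=> [piP piQ].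
have Ifst (g : X -> R) : continuous g -> (forall z, 0 <= g z) ->
    \int[pi]_(zw in [set: borel (X * X)%type]) g zw.1 =
    N%:R^-1 * \sum_i g (atom N0 y i).
  move=> cg g0; rewrite -(Rintegral_tokens cg Py) -piP /Rintegral.
  rewrite (ge0_integral_push pi (continuous_borel (@continuous_fst X X)))//.
  by apply/measurable_EFinP; exact: continuous_borel_real.
have Isnd (g : X -> R) : continuous g -> (forall z, 0 <= g z) ->
    \int[pi]_(zw in [set: borel (X * X)%type]) g zw.2 =
    N%:R^-1 * \sum_i g (atom N0 y' i).
  move=> cg g0; rewrite -(Rintegral_tokens cg Qy') -piQ /Rintegral.
  rewrite (ge0_integral_push pi (continuous_borel (@continuous_snd X X)))//.
  by apply/measurable_EFinP; exact: continuous_borel_real.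
have cfst (g : X -> R) : continuous g -> continuous (fun zw : X * X => g zw.1).
  move=> cg zw; apply: (@continuous_comp _ _ _ fst g); last exact: cg.
  exact: continuous_fst.
have csnd (g : X -> R) : continuous g -> continuous (fun zw : X * X => g zw.2).
  move=> cg zw; apply: (@continuous_comp _ _ _ snd g); last exact: cg.
  exact: continuous_snd.
pose tent := @tent R N d N0 S S0.
have ct i : continuous (tent i) by exact: tent_continuous.
have ctt i j : continuous (fun zw : X * X => tent i zw.1 * tent j zw.2).
  by apply: continuous_mul; [exact: cfst|exact: csnd].
pose a i j := \int[pi]_(zw in [set: borel (X * X)%type]) (tent i zw.1 * tent j zw.2).
have sum_tent_atom i (u : 'I_N -> subT S0) : \sum_j tent i (atom N0 u j) = 1.
  rewrite (bigD1 i)//= /tent tent_atom eqxx big1 ?addr0// => j ji.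
  by rewrite tent_atom eq_sym (negbTE ji).
exists a.
  split => [i j|i|j].
  - by apply: Rintegral_ge0 => zw _; rewrite mulr_ge0// tent_ge0.
  - rewrite -(Rintegral_sum_continuous pi cXX)//.
    under eq_Rintegral do rewrite -mulr_sumr sum_tent mulr1.
    by rewrite Ifst// ?sum_tent_atom ?mulr1// => z; exact: tent_ge0.
  - rewrite -(Rintegral_sum_continuous pi cXX)//.
    under eq_Rintegral do rewrite -mulr_suml sum_tent mul1r.
    by rewrite Isnd// ?sum_tent_atom ?mulr1// => z; exact: tent_ge0.
have cdev : continuous (fun zw : X * X => dev x zw.1 + dev x' zw.2).
  apply: continuous_add; [apply: cfst|apply: csnd]; exact: dev_continuous.
have cc : continuous (fun zw : X * X => \sum_i \sum_j
    token_cost x x' i j * (tent i zw.1 * tent j zw.2)).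
  apply: continuous_sum => i; apply: continuous_sum => j.
  by apply: continuous_mul; [exact: cst_continuous|exact: ctt].
(* Under [pi] both deviations vanish almost surely, which turns the cost into
   a combination of products of tents. *)
transitivity (\int[pi]_(zw in [set: borel (X * X)%type])
    (\sum_i \sum_j token_cost x x' i j * (tent i zw.1 * tent j zw.2))%:E)%E.
  apply: (@eq_integral_off_null _ (borel (X * X)%type) R pi
    (fun zw => (dev x zw.1 + dev x' zw.2)%:E)).
  - by apply/measurable_EFinP; exact: continuous_borel_real cdev.
  - by move=> zw; rewrite lee_fin addr_ge0// dev_ge0.
  - rewrite (EFin_Rintegral_continuous pi cXX cdev).
    rewrite (RintegralD_continuous pi cXX); last 2 first.
      by apply: cfst; exact: dev_continuous.
      by apply: csnd; exact: dev_continuous.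
    rewrite Ifst; [|exact: dev_continuous|exact: dev_ge0].
    rewrite Isnd; [|exact: dev_continuous|exact: dev_ge0].
    by rewrite !big1 ?mulr0 ?addr0// => i _; rewrite dev_atom.
  - by move=> zw; rewrite lee_fin cost_ge0.
  - move=> zw; rewrite lee_fin; do 2 (apply: sumr_ge0 => ? _).
    by rewrite !mulr_ge0 ?tent_ge0// token_cost_ge0.
  move=> [z w] /= [] /eqP; rewrite paddr_eq0 ?dev_ge0// => /andP[/eqP dz /eqP dw].
  congr EFin; have [i zi] := labelP z; have [j wj] := labelP w.
  rewrite /cost zi wj (dev_eq0 zi dz) (dev_eq0 wj dw).
  transitivity (\sum_k tent k z * (\sum_l tent l w * token_cost x x' k l)).
    by rewrite (sum_tent_mul _ zi) (sum_tent_mul _ wj).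
  by apply: eq_bigr => k _; rewrite mulr_sumr; apply: eq_bigr => l _; ring.
rewrite (EFin_Rintegral_continuous pi cXX cc); congr EFin.
rewrite (Rintegral_sum_continuous pi cXX); last first.
  move=> i; apply: continuous_sum => j.
  by apply: continuous_mul; [exact: cst_continuous|exact: ctt].
apply: eq_bigr => i _; rewrite (Rintegral_sum_continuous pi cXX); last first.
  by move=> j; apply: continuous_mul; [exact: cst_continuous|exact: ctt].
by apply: eq_bigr => j _; rewrite (RintegralZ_continuous pi cXX)// mulrC.
Qed.

Lemma sqr_W2_tokens :
  (W2 lambda P Q ^+ 2 = (transport (token_cost x x'))%:E)%E.
Proof.
have tc0 := token_cost_ge0 x x'.
rewrite /W2; set E := [set _ | _ in _].
have E0 : (0 <= ereal_inf E)%E.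
  apply: le_ereal_inf_tmp => _ [pi _ <-]; apply: integral_ge0 => zw _.
  by rewrite lee_fin cost_ge0.
have Ea a : plans a -> (ereal_inf E <= (plan_cost (token_cost x x') a)%:E)%E.
  move=> /plan_coupling[pi cpi <-]; apply: ereal_inf_lbound; by exists pi.
rewrite sqr_sqrte//; apply/eqP; rewrite eq_le; apply/andP; split; last first.
  apply: le_ereal_inf_tmp => _ [pi /coupling_plan[a pa ->] <-].
  by rewrite lee_fin; exact: transport_le.
(* Any plan bounds the infimum from above, so the comparison with the real-valued [transport] can
   take place in the reals. *)
have fE : ereal_inf E \is a fin_num.
  have [a pa] := plans_neq0 R N0.
  by rewrite ge0_fin_numE// (le_lt_trans (Ea a pa))// ltry.
rewrite -(fineK fE) lee_fin; apply: (le_transport N0) => a pa.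
by rewrite -lee_fin fineK// Ea.
Qed.

End transport_tokens.

(** * The flow of the tokens *)

Section continuous_matrix.
Context (R : realType) (T : topologicalType).

Lemma continuous_entry m n (M : T -> 'M[R]_(m, n)) i j :
  continuous M -> continuous (fun t => M t i j).
Proof.
move=> cM t; apply: (@continuous_comp _ _ _ M (fun A : 'M[R]_(m, n) => A i j)).
  exact: cM.
exact: coord_continuous.
Qed.

Lemma continuous_mulmx_var m n p (M : T -> 'M[R]_(m, n)) (M' : T -> 'M[R]_(n, p)) :
  continuous M -> continuous M' -> continuous (fun t => M t *m M' t).
Proof.
move=> cM cM'; apply: continuous_mx => i j; under eq_fun do rewrite mxE.
apply: continuous_sum => k; apply: continuous_mul; exact: continuous_entry.
Qed.

Lemma continuous_addmx m n (M M' : T -> 'M[R]_(m, n)) :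
  continuous M -> continuous M' -> continuous (fun t => M t + M' t).
Proof.
move=> cM cM'; apply: continuous_mx => i j; under eq_fun do rewrite mxE.
apply: continuous_add; exact: continuous_entry.
Qed.

End continuous_matrix.

Section token_flow.
Context (R : realType) (N d d1 d2 : nat) (N0 : (0 < N)%N) (beta : R).
Context (sigma : 'cV[R]_d1 -> 'cV[R]_d1).
Hypothesis sigma_lip : forall u v, enorm (sigma u - sigma v) <= enorm (u - v).
Local Notation param := (param R d d1 d2).
Implicit Types (x : 'I_N -> 'cV[R]_d) (U : param).

Local Notation pW U := (U.1.1.1.1.1).
Local Notation pA U := (U.1.1.1.1.2).
Local Notation pb U := (U.1.1.1.2).
Local Notation pQ U := (U.1.1.2).
Local Notation pK U := (U.1.2).
Local Notation pV U := (U.2).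

Definition weight U x i j : R := expR (beta * dotp (pQ U *m x i) (pK U *m x j)).

(** The factors [N%:R^-1] are kept so that numerator and denominator are literally the two attention
    integrals against a token measure. *)
Definition token_layer U x i : 'cV[R]_d :=
  pW U *m sigma (pA U *m x i + pb U) +
  \col_k ((N%:R^-1 * \sum_j (weight U x i j * (pV U *m x j) k 0)) /
          (N%:R^-1 * \sum_j weight U x i j)).

Definition token_flow (I : Type) (s : seq I) (U : I -> param) x :=
  foldl (fun x t => token_layer (U t) x) x s.

Section continuity.
Context (Y : topologicalType).

Lemma token_layer_continuous (U : Y -> param) (x : Y -> 'I_N -> 'cV[R]_d) i :
  continuous U -> (forall i, continuous (fun t => x t i)) ->
  continuous (fun t => token_layer (U t) (x t) i).
Proof.
move=> cU cx.
have c1 : continuous (fun t => (U t).1).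
  by move=> t; apply: (@continuous_comp _ _ _ U fst); [exact: cU|exact: continuous_fst].
have cV : continuous (fun t => pV (U t)).
  by move=> t; apply: (@continuous_comp _ _ _ U snd); [exact: cU|exact: continuous_snd].
have c2 : continuous (fun t => (U t).1.1).
  by move=> t; apply: (@continuous_comp _ _ _ (fun t => (U t).1) fst);
    [exact: c1|exact: continuous_fst].
have cK : continuous (fun t => pK (U t)).
  by move=> t; apply: (@continuous_comp _ _ _ (fun t => (U t).1) snd);
    [exact: c1|exact: continuous_snd].
have c3 : continuous (fun t => (U t).1.1.1).
  by move=> t; apply: (@continuous_comp _ _ _ (fun t => (U t).1.1) fst);
    [exact: c2|exact: continuous_fst].
have cQ : continuous (fun t => pQ (U t)).
  by move=> t; apply: (@continuous_comp _ _ _ (fun t => (U t).1.1) snd);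
    [exact: c2|exact: continuous_snd].
have c4 : continuous (fun t => (U t).1.1.1.1).
  by move=> t; apply: (@continuous_comp _ _ _ (fun t => (U t).1.1.1) fst);
    [exact: c3|exact: continuous_fst].
have cb : continuous (fun t => pb (U t)).
  by move=> t; apply: (@continuous_comp _ _ _ (fun t => (U t).1.1.1) snd);
    [exact: c3|exact: continuous_snd].
have cW : continuous (fun t => pW (U t)).
  by move=> t; apply: (@continuous_comp _ _ _ (fun t => (U t).1.1.1.1) fst);
    [exact: c4|exact: continuous_fst].
have cA : continuous (fun t => pA (U t)).
  by move=> t; apply: (@continuous_comp _ _ _ (fun t => (U t).1.1.1.1) snd);
    [exact: c4|exact: continuous_snd].
have cw j : continuous (fun t => weight (U t) (x t) i j).
  move=> t; apply: continuous_comp; last exact: continuous_expR.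
  move: t; apply: continuous_mul; first exact: cst_continuous.
  apply: continuous_sum => k; apply: continuous_mul; apply: continuous_entry;
    exact: continuous_mulmx_var.
apply: continuous_addmx.
  apply: continuous_mulmx_var => // t.
  apply: (@continuous_comp _ _ _ (fun t => pA (U t) *m x t i + pb (U t)) sigma).
    by move: t; apply: continuous_addmx => //; exact: continuous_mulmx_var.
  exact: lip_continuous.
apply: continuous_mx => k l; under eq_fun do rewrite mxE.
apply: continuous_mul.
  apply: continuous_mul; first exact: cst_continuous.
  apply: continuous_sum => j; apply: continuous_mul => //.
  by apply: continuous_entry; exact: continuous_mulmx_var.
have cs : continuous (fun t => N%:R^-1 * \sum_j weight (U t) (x t) i j).
  by apply: continuous_mul; [exact: cst_continuous|exact: continuous_sum].
move=> t; apply: (cvgV _ (cs t)).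
rewrite gt_eqF// mulr_gt0 ?invr_gt0 ?ltr0n//.
by rewrite (bigD1 i)//= ltr_pwDl ?expR_gt0// sumr_ge0// => j _; exact: expR_ge0.
Qed.

(** Letting the initial tokens depend on the parameter in [Y] makes the induction over the layers go
    through: the output of one layer is again such a family. *)
Lemma token_flow_continuous (I : Type) (s : seq I) (U : Y -> I -> param)
    (x : Y -> 'I_N -> 'cV[R]_d) i :
  (forall t, continuous (U ^~ t)) -> (forall i, continuous (fun t => x t i)) ->
  continuous (fun t => token_flow s (U t) (x t) i).
Proof.
move=> cU; elim: s x => [|t s IH] x cx /=; first exact: cx.
apply: (IH (fun y => token_layer (U y t) (x y))) => j.
exact: token_layer_continuous.
Qed.

End continuity.

Context (S : set 'cV[R]_d) (S0 : S !=set0) (cS : compact S).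
Context (UU : set param) (HS : layer_valued N0 beta S0 sigma UU).
Local Notation X := (state N0 S0).
Implicit Types (mu : Prob R X) (y : 'I_N -> subT S0).

Lemma layer_tokens mu y U i : is_tokens mu y ->
  layer beta sigma (val (y i)) U mu = token_layer U (fun i => val (y i)) i.
Proof.
move=> my; case: U => [[[[[W A] b] Q] K] V]; rewrite /layer /token_layer /=.
have nuy : atomic (push snd mu : Prob R (subT S0)) (fun=> N%:R^-1) y.
  apply: (push_atomic _ my); apply: continuous_borel; exact: continuous_snd.
have cv : continuous (val : subT S0 -> 'cV[R]_d) by exact: continuous_val.
have cw : continuous (fun z : subT S0 =>
    expR (beta * dotp (Q *m val (y i)) (K *m val z))).
  move=> z; apply: continuous_comp; last exact: continuous_expR.
  move: z; apply: continuous_mul; first exact: cst_continuous.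
  apply: continuous_sum => k; apply: continuous_mul; first exact: cst_continuous.
  by apply: coordC; exact: continuous_mulmx.
have w0 (j : 'I_N) : 0 <= N%:R^-1 :> R by rewrite invr_ge0.
congr (_ + _); apply/colP => k; rewrite !mxE.
rewrite (Rintegral_atomic w0 nuy); last first.
  apply: continuous_borel_real; apply: continuous_mul => //.
  by apply: coordC; exact: continuous_mulmx.
rewrite (Rintegral_atomic w0 nuy); last exact: continuous_borel_real.
by rewrite -!mulr_sumr.
Qed.

Lemma Phi_tokens mu y (U : set_type UU) : is_tokens mu y ->
  exists2 y', is_tokens (Phi HS mu U) y' &
    (fun i => val (y' i)) = token_layer (val U) (fun i => val (y i)).
Proof.
move=> my; exists (fun i => (f HS (atom N0 y i) U mu).2).
  (* [f] leaves the label untouched, so its composition with [atom N0 y] is convertible to the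
     [atom] map of the new tokens. *)
  have := push_atomic (f_borel HS U mu cS sigma_lip) my.
  by [].
by apply/funext => i /=; rewrite -(layer_tokens _ _ my).
Qed.

Lemma PhiT_tokens T mu y (U : controls T UU) : is_tokens mu y ->
  exists2 y', is_tokens (PhiT HS mu U) y' &
    (fun i => val (y' i)) =
    token_flow (enum 'I_T) (fun t => val (U t)) (fun i => val (y i)).
Proof.
rewrite /PhiT; elim: (enum 'I_T) mu y => [|t s IH] mu y my /=; first by exists y.
have [y1 my1 y1E] := Phi_tokens (U t) my.
by have [y' my' y'E] := IH _ _ my1; exists y' => //; rewrite y'E y1E.
Qed.

End token_flow.

(** * Compactness of the controls and convergent subsequences *)

Lemma set_type_val_continuous (Y : topologicalType) (A : set Y) :
  continuous (val : set_type A -> Y).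
Proof. exact: (@initial_continuous _ _ (set_val : set_type A -> Y)). Qed.

Lemma near_ball_forall (R : realType) (Y : topologicalType) (I : finType)
    (A : pseudoMetricType R) (h : I -> Y -> A) (t : Y) (e : R) :
  (forall i, continuous (h i)) -> 0 < e ->
  nbhs t [set u | forall i, ball (h i t) e (h i u)].
Proof.
move=> ch e0; apply: filter_forall => i.
by apply: ch; exact: nbhsx_ballx.
Qed.

Section subsequence.
Context (R : realType) (d d1 d2 T : nat) (UU : set (param R d d1 d2)).

Lemma compact_ptws (I : eqType) (A : topologicalType) :
  compact [set: A] -> compact [set: {ptws I -> A}].
Proof.
move=> cA; have := @tychonoff I (fun=> A) (fun=> setT) (fun=> cA).
by rewrite (_ : [set f | _] = setT)//; apply/seteqP; split.
Qed.

Lemma compact_controls : compact UU -> compact [set: controls T UU].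
Proof.
move=> cU; apply: compact_ptws; have [U0|nU] := pselect (UU !=set0).
  exact: (@compact_sub _ UU U0).
(* When [UU] is empty, its subtype has no element and hence no proper filter. *)
move=> F FF _; have [u _] := @filter_ex _ F _ _ (filterT : F setT).
by exfalso; apply: nU; exists (val u); exact: set_mem (valP u).
Qed.

(** Tychonoff's theorem only yields a cluster point. There are finitely many layers, so the sets
    [B n] of controls within 1/(n+1) of it in every layer are neighborhoods, and they shrink fast
    enough to extract a sequence. *)
Lemma controls_subsequence (U : nat -> controls T UU) : compact UU ->
  exists Ustar : controls T UU, exists2 phi : nat -> nat,
    {homo phi : m n / (m < n)%N} & (fun n => U (phi n)) @ \oo --> Ustar.
Proof.
move=> cU; have [Us [_ cl]] :=
  compact_controls cU (fmap_proper_filter U eventually_filter) filterT.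
pose B n := [set u : controls T UU |
  forall t, ball (val (Us t)) n.+1%:R^-1 (val (u t))].
have nB n : nbhs Us (B n).
  apply: (@near_ball_forall R _ _ _
    (fun t (u : controls T UU) => val (u t) : param R d d1 d2)); last by rewrite invr_gt0.
  move=> t u; apply: (@continuous_comp _ _ _ (fun u : controls T UU => u t)
     (val : set_type UU -> param R d d1 d2)).
    exact: ptws_eval_continuous.
  exact: set_type_val_continuous.
have ex mn : exists k, (mn.1 < k)%N /\ B mn.2 (U k).
  have FA : (U @ \oo) (U @` [set k | (mn.1 < k)%N]).
    by exists mn.1.+1 => // k /= mk; exists k.
  by have [_ [[k mk <-] Bk]] := cl _ _ FA (nB mn.2); exists k.
have [g gP] := choice ex.
(* [g (k, n)] is an index beyond [k] whose control lies in [B n]; starting each search from the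
   previous index makes [phi] strictly increasing. *)
pose phi := fix phi n := if n is m.+1 then g (phi m, m.+1) else g (0%N, 0%N).
have Bphi n : B n (U (phi n)) by case: n => [|n];
  [exact: (gP (0%N, 0%N)).2|exact: (gP (phi n, n.+1)).2].
exists Us, phi.
  by apply: homo_ltn => [|n]; [exact: ltn_trans|exact: (gP (phi n, n.+1)).1].
apply: ptws_cvg => t C [_ [[W oW <-] Wx WC]].
have /nbhs_ballP[e /= e0 We] : nbhs (val (Us t)) W by exact: open_nbhs_nbhs.
suff : \forall n \near \oo, C (U (phi n) t) by [].
have := near_infty_natSinv_lt (PosNum e0); apply: filterS => n /= /ltW ne.
by apply: WC; apply: We; exact: (le_ball ne (Bphi n t)).
Qed.

End subsequence.

(** * Passing to the limit *)

(** Here boundedness of [g] stands in for compactness of the space, which is not established for the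
    pairs of measures. *)
Lemma EFin_Rintegral_bounded (R : realType) (T : ptopologicalType) (mu : Prob R T)
    (g : T -> R) : continuous g -> (exists M, forall x, `|g x| <= M) ->
  (\int[mu]_(x in [set: borel T]) (g x)%:E)%E =
  (\int[mu]_(x in [set: borel T]) g x)%:E.
Proof.
move=> cg [M gM]; rewrite /Rintegral fineK//.
apply: integrable_fin_num => //; apply: measurable_bounded_integrable => //.
- by apply: (le_lt_trans (probability_le1 mu measurableT)); rewrite ltry.
- exact: continuous_borel_real.
- exists M; split => [|r Mr x _]; first exact: num_real.
  exact: le_trans (gM x) (ltW Mr).
Qed.

(** A tube-lemma argument: the estimate holds near each point (y, k) by joint continuity, and
    compactness of [K] yields one neighborhood of [y] for all [k]. *)
Lemma near_uniform (R : realType) (Y K : topologicalType) (F : Y * K -> R) :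
  compact [set: K] -> continuous F -> forall y e, 0 < e ->
  \forall y' \near y, forall k, `|F (y', k) - F (y, k)| <= e.
Proof.
move=> cK cF y e e0.
have : \forall y' \near y, [set: K] `<=` [set k | `|F (y', k) - F (y, k)| <= e].
  move/compact_near_coveringP : cK; apply => k _.
  have c0 : continuous (fun ky : K * Y => F (ky.2, ky.1) - F (y, ky.1)).
    apply: continuous_sub => ky.
      apply: (@continuous_comp _ _ _ (fun ky : K * Y => (ky.2, ky.1)) F); last exact: cF.
      by apply: cvg_pair; [exact: continuous_snd|exact: continuous_fst].
    apply: (@continuous_comp _ _ _ (fun ky : K * Y => (y, ky.1)) F); last exact: cF.
    by apply: cvg_pair; [exact: cvg_cst|exact: continuous_fst].
  have := c0 (k, y); rewrite /continuous_at /= subrr.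
  by move=> /(@cvgr0_norm_le _ _ _ (nbhs (k, y))) /(_ e e0).
by apply: filterS => y' h k; exact: h.
Qed.

Section limit.
Context (R : realType) (N d d1 d2 T : nat) (N0 : (0 < N)%N).
Context (beta lambda : R) (l0 : 0 <= lambda).
Context (S : set 'cV[R]_d) (S0 : S !=set0) (cS : compact S).
Context (sigma : 'cV[R]_d1 -> 'cV[R]_d1).
Hypothesis sigma_lip : forall u v, enorm (sigma u - sigma v) <= enorm (u - v).
Context (UU : set (param R d d1 d2)) (cUU : compact UU).
Context (HS : layer_valued N0 beta S0 sigma UU).
Local Notation X := (state N0 S0).
Local Notation PP := (Prob R X * Prob R X)%type.
Implicit Types U : controls T UU.
Local Notation tuple := ('I_N -> subT S0).

Definition score U (x x' : 'I_N -> 'cV[R]_d) : R :=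
  transport (token_cost lambda
    (token_flow beta sigma (enum 'I_T) (fun t => val (U t)) x) x').

Lemma score_ge0 U x x' : 0 <= score U x x'.
Proof. by apply: transport_ge0 => // i j; exact: token_cost_ge0. Qed.

Lemma score_continuous (Y : topologicalType) (U : Y -> controls T UU)
    (x x' : Y -> 'I_N -> 'cV[R]_d) : continuous U ->
  (forall i, continuous (fun t => x t i)) -> (forall i, continuous (fun t => x' t i)) ->
  continuous (fun t => score (U t) (x t) (x' t)).
Proof.
move=> cU cx cx'; apply: (transport_continuous N0) => [t i j|i j].
  exact: token_cost_ge0.
apply: continuous_add; last exact: cst_continuous.
apply: continuous_sqr; apply: enorm_continuous => t.
have cF : continuous (fun t => token_flow beta sigma (enum 'I_T)
    (fun s => val (U t s)) (x t) i).
  apply: (@token_flow_continuous R N d d1 d2 N0 beta sigma sigma_lip Y _ _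
    (fun t s => val (U t s))) => // s {}t.
  apply: (@continuous_comp _ _ _ (fun t => U t s)
     (val : set_type UU -> param R d d1 d2)).
    apply: (@continuous_comp _ _ _ U (fun u : controls T UU => u s)); first exact: cU.
    exact: ptws_eval_continuous.
  exact: set_type_val_continuous.
exact: (cvgB (cF t) (cx' j t)).
Qed.

Local Notation Z := ({ptws 'I_N -> subT S0}).

Let position (z : Z) i : 'cV[R]_d := val (z i).

Let position_cont (Y : topologicalType) (g : Y -> Z) i :
  continuous g -> continuous (fun t => position (g t) i).
Proof.
move=> cg t; apply: (@continuous_comp _ _ _ (fun t => g t i) (val : subT S0 -> 'cV[R]_d)).
  apply: (@continuous_comp _ _ _ g (fun z : Z => z i)); first exact: cg.
  exact: ptws_eval_continuous.
exact: continuous_val.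
Qed.

Let cZ : compact [set: Z].
Proof. by apply: compact_ptws; exact: compact_sub. Qed.

Let score_joint : continuous (fun uz : controls T UU * (Z * Z) =>
  score uz.1 (position uz.2.1) (position uz.2.2)).
Proof.
apply: score_continuous; first exact: continuous_fst.
  move=> i; apply: (position_cont (g := fun uz : controls T UU * (Z * Z) => uz.2.1)) => uz.
  by apply: (@continuous_comp _ _ _ snd fst); [exact: continuous_snd|exact: continuous_fst].
move=> i; apply: (position_cont (g := fun uz : controls T UU * (Z * Z) => uz.2.2)) => uz.
by apply: (@continuous_comp _ _ _ snd snd); exact: continuous_snd.
Qed.

(** Controls and token tuples range over compact spaces on which the score is jointly continuous.
    The bound serves as the truncation level of [tscore]. *)
Lemma score_bounded : exists2 M, 0 <= M & forall U (x y : tuple),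
  score U (fun i => val (x i)) (fun i => val (y i)) <= M.
Proof.
have [|M Mh] := bounded_on_compact _ score_joint.
  rewrite (_ : [set: _] = [set: controls T UU] `*` ([set: Z] `*` [set: Z])).
    by apply: compact_setX; [exact: compact_controls|exact: compact_setX].
  by apply/seteqP; split.
exists `|M| => // U x y; apply: le_trans (ler_norm _) _.
exact: le_trans (Mh (U, (x, y))) (ler_norm _).
Qed.

(** One neighborhood of [U] serves all token pairs, so the error made by changing the control is the
    same for every empirical measure. This is what allows control and measure to vary together in
    the limit. *)
Lemma score_equicontinuous U e : 0 < e ->
  \forall U' \near U, forall x y : tuple,
    `|score U' (fun i => val (x i)) (fun i => val (y i)) -
      score U (fun i => val (x i)) (fun i => val (y i))| <= e.
Proof.
move=> e0; have cZZ : compact [set: Z * Z].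
  rewrite (_ : [set: _] = [set: Z] `*` [set: Z]); first exact: compact_setX.
  by apply/seteqP; split.
have := near_uniform cZZ score_joint U e0.
by apply: filterS => U' h x y; exact: (h (x, y)).
Qed.

Variables (M : R) (M_ge0 : 0 <= M) (scoreM : forall U (x y : tuple),
  score U (fun i => val (x i)) (fun i => val (y i)) <= M).

(* Away from the token measures the barycenters may leave [S], where [score] is
   not bounded by [M]; the truncation keeps it bounded. *)
Definition tscore U (mn : PP) : R := Num.min (score U (bar mn.1) (bar mn.2)) M.

(** Cutting at 1 makes this an admissible test function for weak convergence and leaves its zeros
    unchanged. *)
Definition tdefect (mn : PP) : R := Num.min (defect mn.1 + defect mn.2) 1.

Let cbar1 i : continuous (fun mn : PP => bar mn.1 i).
Proof.
move=> mn; apply: (@continuous_comp _ _ _ fst (fun mu : Prob R X => bar mu i)).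
  exact: continuous_fst.
exact: bar_continuous.
Qed.

Let cbar2 i : continuous (fun mn : PP => bar mn.2 i).
Proof.
move=> mn; apply: (@continuous_comp _ _ _ snd (fun mu : Prob R X => bar mu i)).
  exact: continuous_snd.
exact: bar_continuous.
Qed.

Let continuous_minr (Y : topologicalType) (g : Y -> R) c :
  continuous g -> continuous (fun t => Num.min (g t) c).
Proof. by move=> cg t; apply: continuous_min; [exact: cg|exact: cst_continuous]. Qed.

Lemma tscore_continuous U : continuous (tscore U).
Proof.
apply: continuous_minr; apply: (score_continuous (U := fun=> U)).
- exact: cst_continuous.
- exact: cbar1.
- exact: cbar2.
Qed.

Lemma tdefect_continuous : continuous tdefect.
Proof.
apply: continuous_minr; apply: continuous_add.
  move=> mn; apply: (@continuous_comp _ _ _ fst (fun mu : Prob R X => defect mu)).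
    exact: continuous_fst.
  exact: defect_continuous.
move=> mn; apply: (@continuous_comp _ _ _ snd (fun mu : Prob R X => defect mu)).
  exact: continuous_snd.
exact: defect_continuous.
Qed.

Lemma tscore_ge0 U mn : 0 <= tscore U mn.
Proof. by rewrite le_min score_ge0 /=. Qed.

Lemma tscore_bounded U : exists C, forall mn, `|tscore U mn| <= C.
Proof. by exists M => mn; rewrite ger0_norm ?tscore_ge0// ge_min lexx orbT. Qed.

Lemma tdefect_ge0 mn : 0 <= tdefect mn.
Proof. by rewrite le_min ler01 addr_ge0// defect_ge0. Qed.

Lemma tdefect_bounded : exists C, forall mn, `|tdefect mn| <= C.
Proof. by exists 1 => mn; rewrite ger0_norm ?tdefect_ge0// ge_min lexx orbT. Qed.

Lemma sqr_W2_tscore U (mn : PP) : tdefect mn = 0 ->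
  (W2 lambda (PhiT HS mn.1 U) mn.2 ^+ 2 = (tscore U mn)%:E)%E.
Proof.
case: mn => mu nu; rewrite /tdefect /tscore /= => D0.
have : defect mu + defect nu == 0.
  move: D0; rewrite /Order.min; case: ifPn => [_ -> //|_ /eqP].
  by rewrite oner_eq0.
rewrite paddr_eq0 ?defect_ge0// => /andP[/eqP mu0 /eqP nu0].
have [x mux xE] := defect0_tokens cS mu0; have [y nuy yE] := defect0_tokens cS nu0.
have [x' mux' x'E] := PhiT_tokens sigma_lip cS HS U mux.
apply: etrans (sqr_W2_tokens cS l0 mux' nuy) _; rewrite x'E.
have -> : bar mu = (fun i => val (x i)) by apply/funext => i; rewrite xE.
have -> : bar nu = (fun i => val (y i)) by apply/funext => i; rewrite yE.
(* The barycenters are now known to be tokens in [S], where the truncation at [M] has no effect. *)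
by congr EFin; apply/esym/min_idPl; exact: scoreM.
Qed.

(** The hypothesis makes the set where [tdefect] is nonzero null, and elsewhere the integrands
    agree. It applies both to the empirical measures and to their limit. *)
Lemma V_tscore (Q : Prob R PP) U :
  \int[Q]_(mn in [set: borel PP]) tdefect mn = 0 ->
  V lambda HS Q U = (\int[Q]_(mn in [set: borel PP]) tscore U mn)%:E.
Proof.
move=> Q0; rewrite /V -(EFin_Rintegral_bounded Q (@tscore_continuous U) (tscore_bounded U)).
apply: (@eq_integral_off_null _ (borel PP) R Q (fun mn => (tdefect mn)%:E)).
- by apply/measurable_EFinP; exact: continuous_borel_real tdefect_continuous.
- by move=> mn; rewrite lee_fin tdefect_ge0.
- by rewrite (EFin_Rintegral_bounded Q tdefect_continuous tdefect_bounded) Q0.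
- by move=> mn; apply: expe_ge0; exact: sqrte_ge0.
- by move=> mn; rewrite lee_fin tscore_ge0.
by move=> mn [] /sqr_W2_tscore.
Qed.

Lemma Rintegral_empirical (D : dataset N S0) (g : PP -> R) : continuous g ->
  \int[empirical N0 D]_(mn in [set: borel PP]) g mn =
  (dsize D)%:R^-1 * \sum_(k < dsize D) g (tokens N0 (input k), tokens N0 (output k)).
Proof.
move=> cg; rewrite mulr_sumr; apply: Rintegral_atomic.
- by move=> i; rewrite invr_ge0.
- exact: uniform_atomic.
- exact: continuous_borel_real.
Qed.

Lemma tdefect_tokens (x y : tuple) : tdefect (tokens N0 x, tokens N0 y) = 0.
Proof.
rewrite /tdefect /= !(defect_tokens (@tokens_is_tokens _ _ _ _ _ _ _)) addr0.
by apply/min_idPl.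
Qed.

Lemma empirical_tdefect (D : dataset N S0) :
  \int[empirical N0 D]_(mn in [set: borel PP]) tdefect mn = 0.
Proof.
rewrite Rintegral_empirical; last exact: tdefect_continuous.
by rewrite big1 ?mulr0// => k _; exact: tdefect_tokens.
Qed.

Lemma tscore_tokens U (x y : tuple) : tscore U (tokens N0 x, tokens N0 y) =
  score U (fun i => val (x i)) (fun i => val (y i)).
Proof.
rewrite /tscore /=.
have -> : bar (tokens N0 x) = (fun i => val (x i)).
  by apply/funext => i; exact: bar_tokens (@tokens_is_tokens _ _ _ _ _ _ _).
have -> : bar (tokens N0 y) = (fun i => val (y i)).
  by apply/funext => i; exact: bar_tokens (@tokens_is_tokens _ _ _ _ _ _ _).
by apply/min_idPl; exact: scoreM.
Qed.

(** An empirical measure averages over token pairs, so a comparison there suffices; its weights sum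
    to 1, so [e] enters once. *)
Lemma empirical_le (D : dataset N S0) (g g' : PP -> R) e :
  continuous g -> continuous g' ->
  (forall x y : tuple, g (tokens N0 x, tokens N0 y) <= g' (tokens N0 x, tokens N0 y) + e) ->
  \int[empirical N0 D]_(mn in [set: borel PP]) g mn <=
  \int[empirical N0 D]_(mn in [set: borel PP]) g' mn + e.
Proof.
move=> cg cg' gg'; rewrite !Rintegral_empirical//.
have -> : e = (dsize D)%:R^-1 * \sum_(k < dsize D) e.
  rewrite sumr_const card_ord -(mulr_natl e) mulrA mulVf ?mul1r//.
  by rewrite pnatr_eq0 -lt0n dsize_gt0.
by rewrite -mulrDr ler_wpM2l ?invr_ge0// -big_split/=; apply: ler_sum => k _.
Qed.

Lemma empirical_tscore_le (D : dataset N S0) U U' e :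
  (forall x y : tuple, `|score U' (fun i => val (x i)) (fun i => val (y i)) -
      score U (fun i => val (x i)) (fun i => val (y i))| <= e) ->
  \int[empirical N0 D]_(mn in [set: borel PP]) tscore U mn <=
  \int[empirical N0 D]_(mn in [set: borel PP]) tscore U' mn + e.
Proof.
move=> UU'; apply: (empirical_le _ (@tscore_continuous U) (@tscore_continuous U')) => x y.
rewrite !tscore_tokens; have := UU' x y.
rewrite ler_distl lerBlDr => /andP[h _]; exact: h.
Qed.

End limit.

Theorem corollary14 (R : realType) (N d d1 d2 T : nat)
    (N0 : (0 < N)%N) (d_gt0 : (0 < d)%N) (d1_gt0 : (0 < d1)%N)
    (d2_gt0 : (0 < d2)%N) (T_gt0 : (0 < T)%N)
    (beta lambda : R) (beta_gt0 : 0 < beta) (lambda_gt0 : 0 < lambda)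
    (S : set 'cV[R]_d) (S0 : S !=set0)
    (sigma : 'cV[R]_d1 -> 'cV[R]_d1)
    (sigma_lip : forall u v, enorm (sigma u - sigma v) <= enorm (u - v))
    (UU : set (param R d d1 d2)) (UU0 : UU !=set0)
    (HS : layer_valued N0 beta S0 sigma UU)
    (S_compact : compact S) (UU_compact : compact UU)
    (D : nat -> dataset N S0)
    (P : Prob R (Prob R (state N0 S0) * Prob R (state N0 S0))%type)
    (P_cvg : (fun r => empirical N0 (D r)) @ \oo --> P)
    (U : nat -> controls T UU)
    (U_argmin : forall r, argminV lambda HS (empirical N0 (D r)) (U r)) :
  exists Ustar : controls T UU,
    (exists phi : nat -> nat,
       {homo phi : m n / (m < n)%N} /\ (fun n => U (phi n)) @ \oo --> Ustar) /\
    argminV lambda HS P Ustar.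
Proof.
have l0 := ltW lambda_gt0.
have [Us [phi phi_incr Uphi]] := controls_subsequence U UU_compact.
exists Us; split; first by exists phi.
have [M M0 scoreM] := score_bounded T N0 beta l0 S0 S_compact sigma_lip UU_compact.
pose Q n := empirical N0 (D (phi n)).
have phi_ge n : (n <= phi n)%N.
  by elim: n => // n IH; exact: leq_ltn_trans IH (phi_incr _ _ (ltnSn n)).
have phi_oo : phi @ \oo --> \oo.
  by move=> A [n _ nA]; exists n => // m /= nm; apply: nA; exact: leq_trans nm (phi_ge m).
have Q_cvg : Q @ \oo --> P.
  exact: (cvg_comp phi (fun r => empirical N0 (D r)) phi_oo P_cvg).
pose PP := (Prob R (state N0 S0) * Prob R (state N0 S0))%type.
have int_cvg (g : PP -> R) : continuous g -> (exists C, forall mn, `|g mn| <= C) ->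
    (fun n => \int[Q n]_(mn in [set: borel PP]) g mn) @ \oo -->
    \int[P]_(mn in [set: borel PP]) g mn.
  move=> cg bg.
  apply: (cvg_comp Q (fun mu : Prob R PP => \int[mu]_(mn in [set: borel PP]) g mn) Q_cvg).
  exact: integral_Prob_continuous.
have P0 : \int[P]_(mn in [set: borel PP]) tdefect mn = 0.
  have := int_cvg _ (@tdefect_continuous R N d N0 S S0 S_compact) (tdefect_bounded N0 S0).
  under eq_fun do rewrite empirical_tdefect//.
  by move=> h; apply: (cvg_unique _ h (cvg_cst _)); exact: Rhausdorff.
move=> U'; rewrite (V_tscore l0 S_compact sigma_lip HS M0 scoreM Us P0).
rewrite (V_tscore l0 S_compact sigma_lip HS M0 scoreM U' P0) lee_fin.
apply/ler_addgt0Pr => e e0.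
have near_Us := score_equicontinuous N0 beta l0 S0 S_compact sigma_lip Us e0.
pose I (u : controls T UU) := \int[P]_(mn in [set: borel PP]) tscore beta lambda sigma M u mn.
have cvgI (u : controls T UU) : (fun n => \int[Q n]_(mn in [set: borel PP])
    tscore beta lambda sigma M u mn) @ \oo --> I u.
  apply: int_cvg; last exact: tscore_bounded.
  exact: (@tscore_continuous R N d d1 d2 T N0 beta lambda l0 S S0 S_compact sigma).
(* For large [n], replacing [Us] by [U (phi n)] under [Q n] costs at most [e], and minimality of
   [U (phi n)] then brings in [U']. The moving control occurs only in the middle; both ends have a
   fixed integrand, so weak convergence applies to them. *)
apply: (ler_cvg_to (cvgI Us) (cvgD (cvgI U') (cvg_cst e))).
have [n0 _ near_n0] := Uphi _ near_Us; exists n0 => // n /= n0n.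
apply: le_trans (empirical_tscore_le N0 l0 S_compact sigma_lip scoreM
  (D (phi n)) (near_n0 n n0n)) _.
rewrite lerD2r -lee_fin.
have := U_argmin (phi n) U'.
have Q0 := empirical_tdefect N0 S_compact (D (phi n)).
rewrite (V_tscore l0 S_compact sigma_lip HS M0 scoreM (U (phi n)) Q0).
by rewrite (V_tscore l0 S_compact sigma_lip HS M0 scoreM U' Q0).
Qed.
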